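(* Let $H$ be a Hopf algebra with invertible antipode $S$ over a field $k$. For an $H$-module algebra $A$ let $C_{A\#H}(A)$ be the centraliser of $A$ in the smash product $A\#H$, with the Yetter-Drinfeld structure $$h\Big(\sum_i a_i\# g_i\Big)=\sum_{(h),i}h_{(2)}(a_i)\#S^2(h_{(3)})\,g_i\,S(h_{(1)}),\qquad \psi\Big(\sum_i a_i\# g_i\Big)=\sum_{i,(g_i)}S^{-1}((g_i)_{(2)})\otimes a_i\#(g_i)_{(1)}.$$ (1) The centraliser $C_{A\#H}(A)$ is a commutative algebra in the braided category $\mathcal{YD}(H)$ of Yetter-Drinfeld modules over $H$. (2) Moreover, the centraliser $C_{A\#H}(A)$ is invariant with respect to Morita equivalences in $H\text{-}Mod$, i.e. if $A$ and $B$ are two $H$-module algebras and $M$ is a $B$-$A$-bimodule, equipped with a compatible $H$-action, which induces an equivalence between categories of modules $M\otimes_A-:{}_A(H\text{-}Mod)\to{}_B(H\text{-}Mod)$, then $C_{A\#H}(A)$ and $C_{B\#H}(B)$ are isomorphic as algebras in $\mathcal{YD}(H)$.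
   Context: Sweedler notation is used: $\Delta(h)=\sum_{(h)}h_{(1)}\otimes h_{(2)}$, and $m\mapsto\sum_{(m)} m_{(-1)}\otimes m_{(0)}\in H\otimes M$ for a left $H$-comodule $M$. An $H$-module algebra is an algebra in the monoidal category $H\text{-}Mod$ of left $H$-modules, i.e. an associative unital algebra $A$ with a left $H$-module structure such that $h(ab)=\sum_{(h)}h_{(1)}(a)h_{(2)}(b)$ and $h(1)=\varepsilon(h)1$. The category ${}_A(H\text{-}Mod)$ consists of left $A$-modules $N$ with a left $H$-module structure such that $h(an)=\sum_{(h)}h_{(1)}(a)h_{(2)}(n)$. A compatible $H$-action on a $B$-$A$-bimodule $M$ is a left $H$-module structure such that $h(bma)=\sum_{(h)}h_{(1)}(b)\,h_{(2)}(m)\,h_{(3)}(a)$. The smash product $A\#H$ is the vector space $A\otimes H$ (with $a\otimes h$ written $a\#h$) with multiplication $(a\#g)(b\#h)=\sum_{(g)}a\,g_{(1)}(b)\#g_{(2)}h$. The centraliser is $C_{A\#H}(A)=\{x\in A\#H\mid x(b\#1)=(b\#1)x\ \text{for all } b\in A\}$. A Yetter-Drinfeld module over $H$ is a left $H$-module $M$ with a left $H$-comodule structure such that $$\sum h_{(1)}m_{(-1)}\otimes h_{(2)}m_{(0)}=\sum (h_{(1)}m)_{(-1)}h_{(2)}\otimes (h_{(1)}m)_{(0)}.$$ Morphisms are $H$-linear and $H$-colinear maps. The category $\mathcal{YD}(H)$ is monoidal (tensor product of modules and comodules) and braided with $c_{M,N}(m\otimes n)=\sum_{(m)}m_{(-1)}n\otimes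 m_{(0)}$. An algebra $C$ in $\mathcal{YD}(H)$ is commutative if $ab=\sum_{(a)}a_{(-1)}(b)\,a_{(0)}$ for all $a,b\in C$. The centraliser is regarded as an algebra in $\mathcal{YD}(H)$ through its identification with the full centre $Z(A)$ of $A$, which is the terminal object $(Z(A),\zeta_A)$ among pairs $(Z,\zeta)$ with $Z\in\mathcal{YD}(H)$ and $\zeta:Z\to A$ an $H$-linear map such that $\zeta(z)a=\sum_{(z)}z_{(-1)}(a)\zeta(z_{(0)})$ for all $z\in Z$, $a\in A$. Under this identification the map $a\#h\mapsto S^{-1}(h)\otimes a$ is an embedding of algebras of $C_{A\#H}(A)$ into $H\otimes A$ with the tensor product multiplication $(g\otimes a)(h\otimes b)=gh\otimes ab$.
   Formalization: The printed action need not preserve the centraliser (e.g. Sweedler's algebra); proved instead with action h_(2)(a)#h_(3) g S^{-1}(h_(1)), coaction S(g_(2))⊗a#g_(1) and embedding a#h ↦ S(h)⊗a; these agree with the printed ones when S^2=id. *)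

(* Defs.v *)
From HB Require Import structures.
From mathcomp Require Import all_boot all_algebra.
From mathcomp Require Import boolp.

Set Implicit Arguments.
Unset Strict Implicit.
Unset Printing Implicit Defensive.

Import GRing.Theory.
Local Open Scope ring_scope.
Local Open Scope quotient_scope.

Definition bilin (k : fieldType) (U V W : lmodType k) (f : U -> V -> W) : Prop :=
  (forall v, linear (f^~ v)) /\ (forall u, linear (f u)).

(** * Tensor products *)

(** [tens ra la] is the vector space [V (x)_R W], where [R] acts on [V] on the
    right through [ra] and on [W] on the left through [la]: formal sums of pairs
    modulo the linear congruence generated by additivity in each variable,
    [(a *: v, w) ~ (v, a *: w)] and [(ra v r, w) ~ (v, la r w)]. *)
Section Tensor.
Variables (k : fieldType) (V W : lmodType k) (R : Type).
Variables (ra : V -> R -> V) (la : R -> W -> W).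

Definition fscale (a : k) (s : seq (V * W)) := [seq (a *: p.1, p.2) | p <- s].

Inductive teq : seq (V * W) -> seq (V * W) -> Prop :=
| teq_refl s : teq s s
| teq_sym s t : teq s t -> teq t s
| teq_trans s t u : teq s t -> teq t u -> teq s u
| teq_cat s s' t t' : teq s s' -> teq t t' -> teq (s ++ t) (s' ++ t')
| teq_catC s t : teq (s ++ t) (t ++ s)
| teq_fscale a s t : teq s t -> teq (fscale a s) (fscale a t)
| teq_zero w : teq [:: (0, w)] [::]
| teq_addl v v' w : teq [:: (v + v', w)] [:: (v, w); (v', w)]
| teq_addr v w w' : teq [:: (v, w + w')] [:: (v, w); (v, w')]
| teq_scale a v w : teq [:: (a *: v, w)] [:: (v, a *: w)]
| teq_bal v r w : teq [:: (ra v r, w)] [:: (v, la r w)].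

Definition teqb s t := `[< teq s t >].

Lemma teqb_refl : reflexive teqb.
Proof. by move=> s; apply/asboolP; apply: teq_refl. Qed.
Lemma teqb_sym : symmetric teqb.
Proof. by move=> s t; apply/asboolP/asboolP; apply: teq_sym. Qed.
Lemma teqb_trans : transitive teqb.
Proof.
by move=> t s u /asboolP st /asboolP tu; apply/asboolP; apply: teq_trans tu.
Qed.

Canonical teq_equiv := EquivRel teqb teqb_refl teqb_sym teqb_trans.

Definition tens : Type := {eq_quot teq_equiv}.
HB.instance Definition _ := EqQuotient.on tens.
HB.instance Definition _ := Choice.on tens.

Definition tcls (s : seq (V * W)) : tens := \pi_tens s.

Lemma tcls_repr (x : tens) : tcls (repr x) = x.
Proof. exact: reprK. Qed.

Lemma tclsP s t : tcls s = tcls t <-> teq s t.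
Proof.
split; first by move/eqmodP/asboolP.
by move=> st; apply/eqmodP/asboolP.
Qed.

Lemma repr_tcls s : teq (repr (tcls s)) s.
Proof. by apply/tclsP; rewrite tcls_repr. Qed.

Definition tpure (v : V) (w : W) : tens := tcls [:: (v, w)].
Definition tadd (x y : tens) := tcls (repr x ++ repr y).
Definition tscale (a : k) (x : tens) := tcls (fscale a (repr x)).
Definition tzero := tcls [::].
Definition topp (x : tens) := tscale (-1) x.

Lemma tadd_tcls s t : tadd (tcls s) (tcls t) = tcls (s ++ t).
Proof. by apply/tclsP; apply: teq_cat; apply: repr_tcls. Qed.
Lemma tscale_tcls a s : tscale a (tcls s) = tcls (fscale a s).
Proof. by apply/tclsP; apply: teq_fscale; apply: repr_tcls. Qed.

Lemma tens_clsW (P : tens -> Prop) : (forall s, P (tcls s)) -> forall x, P x.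
Proof. by move=> h x; rewrite -[x]tcls_repr. Qed.

Lemma taddA : associative tadd.
Proof.
elim/tens_clsW=> s; elim/tens_clsW=> t; elim/tens_clsW=> u.
by rewrite !tadd_tcls catA.
Qed.
Lemma taddC : commutative tadd.
Proof.
elim/tens_clsW=> s; elim/tens_clsW=> t; rewrite !tadd_tcls.
by apply/tclsP; apply: teq_catC.
Qed.
Lemma tadd0 : left_id tzero tadd.
Proof. by elim/tens_clsW=> s; rewrite tadd_tcls. Qed.

Lemma fscale_cat a s t : fscale a (s ++ t) = fscale a s ++ fscale a t.
Proof. exact: map_cat. Qed.

Lemma tscaleDr a x y : tscale a (tadd x y) = tadd (tscale a x) (tscale a y).
Proof.
elim/tens_clsW: x=> s; elim/tens_clsW: y=> t.
by rewrite !(tadd_tcls, tscale_tcls) fscale_cat.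
Qed.
Lemma tscaleA a b x : tscale a (tscale b x) = tscale (a * b) x.
Proof.
elim/tens_clsW: x=> s; rewrite !tscale_tcls /fscale -map_comp.
by congr tcls; apply: eq_map => p /=; rewrite scalerA.
Qed.
Lemma tscale1 x : tscale 1 x = x.
Proof.
elim/tens_clsW: x=> s; rewrite !tscale_tcls /fscale.
by congr tcls; rewrite -[RHS]map_id; apply: eq_map => -[v w] /=; rewrite scale1r.
Qed.
Lemma tscaleDl a b x : tscale (a + b) x = tadd (tscale a x) (tscale b x).
Proof.
elim/tens_clsW: x=> s; elim: s => [|[v w] s IH].
  by rewrite !tscale_tcls tadd_tcls.
rewrite -cat1s -tadd_tcls !tscaleDr {}IH.
have -> : tscale (a + b) (tcls [:: (v, w)]) =
    tadd (tscale a (tcls [:: (v, w)])) (tscale b (tcls [:: (v, w)])).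
  rewrite !tscale_tcls tadd_tcls /=; apply/tclsP; rewrite scalerDl.
  exact: teq_addl.
by rewrite -!taddA; congr tadd; rewrite taddC -taddA [X in tadd _ X]taddC.
Qed.
Lemma tscale0 x : tscale 0 x = tzero.
Proof.
elim/tens_clsW: x=> s; elim: s => [|[v w] s IH]; first by rewrite tscale_tcls.
rewrite -cat1s -tadd_tcls tscaleDr IH tscale_tcls /= scale0r.
by rewrite taddC tadd0; apply/tclsP; apply: teq_zero.
Qed.
Lemma taddN : left_inverse tzero topp tadd.
Proof.
by move=> x; rewrite /topp -{2}[x]tscale1 -tscaleDl addNr tscale0.
Qed.

HB.instance Definition _ := GRing.isZmodule.Build tens taddA taddC tadd0 taddN.
HB.instance Definition _ := GRing.Zmodule_isLmodule.Build k tens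
  tscaleA tscale1 tscaleDr (fun x a b => tscaleDl a b x).

Lemma tclsD s t : tcls (s ++ t) = tcls s + tcls t.
Proof. by rewrite -tadd_tcls. Qed.
Lemma tcls_scale a s : tcls (fscale a s) = a *: tcls s.
Proof. by rewrite -tscale_tcls. Qed.

Lemma tclsE s : tcls s = \sum_(p <- s) tpure p.1 p.2.
Proof.
elim: s => [|[v w] s IH]; first by rewrite big_nil.
by rewrite big_cons -IH -cat1s tclsD.
Qed.

Lemma tensE (x : tens) : x = \sum_(p <- repr x) tpure p.1 p.2.
Proof. by rewrite -tclsE tcls_repr. Qed.

Lemma tpure_bilin : bilin tpure.
Proof.
have sc a v w : tpure (a *: v) w = a *: tpure v w by rewrite -tcls_scale.
split=> [w a v v'|v a w w'] /=.
  rewrite -sc -tclsD; apply/tclsP; exact: teq_addl.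
have -> : tpure v (a *: w + w') = tpure v (a *: w) + tpure v w'.
  by rewrite -tclsD; apply/tclsP; apply: teq_addr.
by rewrite -sc; congr (_ + _); apply/tclsP; apply: teq_sym; apply: teq_scale.
Qed.

Lemma tpure_bal v r w : tpure (ra v r) w = tpure v (la r w).
Proof. by apply/tclsP; apply: teq_bal. Qed.

(** [tev b x] is the sum of the [b v w] over a presentation [x = sum v (x) w].
    It is meaningful for bilinear balanced [b], by [tev_tcls] below: then it is
    the value at [x] of the linear map induced by [b]. *)
Definition tev (U : lmodType k) (b : V -> W -> U) (x : tens) : U :=
  \sum_(p <- repr x) b p.1 p.2.

Section Universal.
Variables (U : lmodType k) (b : V -> W -> U).
Hypotheses (b_bilin : bilin b) (b_bal : forall v r w, b (ra v r) w = b v (la r w)).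

Let bD v v' w : b (v + v') w = b v w + b v' w.
Proof. by have := b_bilin.1 w 1 v v'; rewrite /= !scale1r. Qed.
Let b0 w : b 0 w = 0.
Proof. by apply: (@addrI _ (b 0 w)); rewrite -bD !addr0. Qed.
Let bZ a v w : b (a *: v) w = a *: b v w.
Proof. by have := b_bilin.1 w a v 0; rewrite /= b0 !addr0. Qed.
Let bDr v w w' : b v (w + w') = b v w + b v w'.
Proof. by have := b_bilin.2 v 1 w w'; rewrite /= !scale1r. Qed.
Let b0r v : b v 0 = 0.
Proof. by apply: (@addrI _ (b v 0)); rewrite -bDr !addr0. Qed.
Let bZr a v w : b v (a *: w) = a *: b v w.
Proof. by have := b_bilin.2 v a w 0; rewrite /= b0r !addr0. Qed.

Lemma teq_sum s t : teq s t ->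
  \sum_(p <- s) b p.1 p.2 = \sum_(p <- t) b p.1 p.2.
Proof.
have fs a u : \sum_(p <- fscale a u) b p.1 p.2 = a *: \sum_(p <- u) b p.1 p.2.
  by rewrite big_map scaler_sumr; apply: eq_bigr => p _ /=; rewrite bZ.
elim=> {s t}.
- by [].
- by move=> s t _ ->.
- by move=> s t u _ -> _ ->.
- by move=> s s' t t' _ IHs _ IHt; rewrite !big_cat /= IHs IHt.
- by move=> s t; rewrite !big_cat /= addrC.
- by move=> a s t _ IH; rewrite !fs IH.
- by move=> w; rewrite big_seq1 big_nil b0.
- by move=> v v' w; rewrite !big_cons !big_nil !addr0 bD.
- by move=> v w w'; rewrite !big_cons !big_nil !addr0 bDr.
- by move=> a v w; rewrite !big_seq1 bZ bZr.
- by move=> v r w; rewrite !big_seq1 b_bal.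
Qed.

Lemma tev_tcls s : tev b (tcls s) = \sum_(p <- s) b p.1 p.2.
Proof. exact/teq_sum/repr_tcls. Qed.

Lemma tev_pure v w : tev b (tpure v w) = b v w.
Proof. by rewrite tev_tcls big_seq1. Qed.

Lemma tev_linear : linear (tev b).
Proof.
move=> a; elim/tens_clsW=> s; elim/tens_clsW=> t.
rewrite -tcls_scale -tclsD !tev_tcls big_cat /=; congr (_ + _).
by rewrite big_map scaler_sumr; apply: eq_bigr => p _ /=; rewrite bZ.
Qed.
End Universal.

Lemma lin_sum (U U' : lmodType k) (f : U -> U') (I : Type) (r : seq I) (F : I -> U) :
  linear f -> f (\sum_(i <- r) F i) = \sum_(i <- r) f (F i).
Proof.
move=> lf; have f0 : f 0 = 0.
  by have := lf (-1) 0 0; rewrite scaler0 addr0 scaleN1r addNr.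
elim: r => [|i r IH]; first by rewrite !big_nil.
by rewrite !big_cons -IH; have := lf 1 (F i); rewrite !scale1r; apply.
Qed.

Lemma lin_tev (U U' : lmodType k) (f : U -> U') (b : V -> W -> U) x :
  linear f -> f (tev b x) = tev (fun v w => f (b v w)) x.
Proof. exact: lin_sum. Qed.

Lemma eq_tev (U : lmodType k) (b c : V -> W -> U) x :
  (forall v w, b v w = c v w) -> tev b x = tev c x.
Proof. by move=> bc; apply: eq_bigr => p _; apply: bc. Qed.

Lemma tev_param_linear (U U' : lmodType k) (b : U -> V -> W -> U') x :
  (forall v w, linear (fun u => b u v w)) -> linear (fun u => tev (b u) x).
Proof.
move=> lb a u u'; rewrite /tev scaler_sumr -big_split.
by apply: eq_bigr => p _; apply: lb.
Qed.

Lemma tens_ext (U : lmodType k) (f g : tens -> U) : linear f -> linear g ->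
  (forall v w, f (tpure v w) = g (tpure v w)) -> f =1 g.
Proof.
move=> lf lg fg x; rewrite [x]tensE !lin_sum //.
by apply: eq_bigr => p _; apply: fg.
Qed.

End Tensor.

Lemma lin_id (k : fieldType) (U : lmodType k) : linear (fun u : U => u).
Proof. by []. Qed.

Lemma lin_comp (k : fieldType) (U V W : lmodType k) (g : V -> W) (f : U -> V) :
  linear g -> linear f -> linear (fun u => g (f u)).
Proof. by move=> lg lf a u u'; rewrite lf lg. Qed.

Lemma lin_scale (k : fieldType) (U V : lmodType k) (f : U -> V) :
  linear f -> forall a u, f (a *: u) = a *: f u.
Proof.
move=> lf a u; have f0 : f 0 = 0.
  by have := lf (-1) 0 0; rewrite scaler0 addr0 scaleN1r addNr.
by have := lf a u 0; rewrite f0 !addr0.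
Qed.

Lemma tevC (k : fieldType) (V W V' W' U : lmodType k) (R R' : Type)
    (ra : V -> R -> V) (la : R -> W -> W) (ra' : V' -> R' -> V') (la' : R' -> W' -> W')
    (b : V -> W -> V' -> W' -> U) (x : tens ra la) (y : tens ra' la') :
  tev (fun v w => tev (b v w) y) x = tev (fun v' w' => tev (fun v w => b v w v' w') x) y.
Proof. exact: exchange_big. Qed.

Definition noactr (V : Type) (v : V) (_ : void) : V := v.
Definition noactl (W : Type) (_ : void) (w : W) : W := w.


Notation "V ⊗ W" := (tens (@noactr V) (@noactl W))
  (at level 40, left associativity) : type_scope.
Notation "v ⊗ w" := (tpure (@noactr _) (@noactl _) v w) : ring_scope.
(** Sweedler's notation: [\ten_(v, w <- x) E] is the sum of [E] over a
    presentation of [x] as a sum of [v ⊗ w]. *)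
Notation "\ten_ ( v , w <- x ) E" := (tev (fun v w => E) x)
  (at level 41, v name, w name, x at level 50, E at level 41,
   format "\ten_ ( v ,  w  <-  x )  E") : ring_scope.

(** * Hopf algebras and their modules *)

(** Hopf algebras with invertible antipode. They are nonzero, by [counit1], so that
    [algType], which excludes the zero algebra, loses nothing. *)
Record hopfAlgebra (k : fieldType) := HopfAlgebra {
  hopf_alg :> algType k;
  cop : hopf_alg -> (hopf_alg ⊗ hopf_alg)%type;
  counit : hopf_alg -> k;
  antipode : hopf_alg -> hopf_alg;
  antipodeV : hopf_alg -> hopf_alg;
  cop_linear : linear cop;
  counit_linear : scalar counit;
  antipode_linear : linear antipode;
  copA : forall h,
    \ten_(h1, h' <- cop h) \ten_(h2, h3 <- cop h') h1 ⊗ (h2 ⊗ h3) =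
    \ten_(h', h3 <- cop h) \ten_(h1, h2 <- cop h') h1 ⊗ (h2 ⊗ h3);
  counitl : forall h, \ten_(h1, h2 <- cop h) (counit h1 *: h2) = h;
  counitr : forall h, \ten_(h1, h2 <- cop h) (counit h2 *: h1) = h;
  cop1 : cop 1 = 1 ⊗ 1;
  copM : forall g h, cop (g * h) =
    \ten_(g1, g2 <- cop g) \ten_(h1, h2 <- cop h) (g1 * h1) ⊗ (g2 * h2);
  counit1 : counit 1 = 1;
  counitM : forall g h, counit (g * h) = counit g * counit h;
  antipodel : forall h, \ten_(h1, h2 <- cop h) (antipode h1 * h2) = (counit h)%:A;
  antipoder : forall h, \ten_(h1, h2 <- cop h) (h1 * antipode h2) = (counit h)%:A;
  antipodeK : cancel antipode antipodeV;
  antipodeVK : cancel antipodeV antipode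
}.

Section HopfTheory.
Variables (k : fieldType) (H : hopfAlgebra k).

Lemma mul_bilin (A : algType k) : bilin (fun a b : A => a * b).
Proof.
split=> [b a x y|b a x y] /=; first by rewrite mulrDl scalerAl.
by rewrite mulrDr scalerAr.
Qed.

Lemma copA3 (U : lmodType k) (T : H -> H -> H -> U) (h : H) :
  (forall y z, linear (fun x => T x y z)) -> (forall x z, linear (fun y => T x y z)) ->
  (forall x y, linear (T x y)) ->
  \ten_(h1, h' <- cop h) \ten_(h2, h3 <- cop h') T h1 h2 h3 =
  \ten_(h', h3 <- cop h) \ten_(h1, h2 <- cop h') T h1 h2 h3.
Proof.
move=> T1 T2 T3.
have bT x : bilin (T x) by split=> [z|y]; [apply: T2 | apply: T3].
have lT x : linear (tev (T x) (ra:=@noactr H) (la:=@noactl H)) by apply: tev_linear.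
have bF : bilin (fun x (t : (H ⊗ H)%type) => tev (T x) t).
  by split=> [t|x]; [apply: tev_param_linear => y z; apply: T1 | apply: lT].
pose F (t : (H ⊗ (H ⊗ H))%type) := tev (fun x t => tev (T x) t) t.
have lF : linear F by apply: tev_linear.
have Fp x y z : F (x ⊗ (y ⊗ z)) = T x y z by rewrite /F !tev_pure.
have := congr1 F (copA h); rewrite !(lin_tev _ _ lF) => E.
transitivity (tev (fun v w => F (\ten_(h2, h3 <- cop w) v ⊗ (h2 ⊗ h3))) (cop h)).
  apply: eq_tev => x t; rewrite (lin_tev _ _ lF); apply: eq_tev => y z.
  by rewrite Fp.
rewrite E; apply: eq_tev => t z; rewrite (lin_tev _ _ lF).
by apply: eq_tev => x y; rewrite Fp.
Qed.
End HopfTheory.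

Definition is_hmodule (k : fieldType) (H : hopfAlgebra k) (V : lmodType k)
    (act : H -> V -> V) : Prop :=
  [/\ bilin act, forall m, act 1 m = m & forall g h m, act (g * h) m = act g (act h m)].

Definition is_algebra (k : fieldType) (V : lmodType k) (mul : V -> V -> V) (one : V) : Prop :=
  [/\ bilin mul, associative mul, left_id one mul & right_id one mul].

Record hmodule (k : fieldType) (H : hopfAlgebra k) := HModule {
  hmod :> lmodType k;
  hact : H -> hmod -> hmod;
  hact_hmodule : is_hmodule hact
}.

(** Algebras in the monoidal category of [H]-modules; the zero algebra is allowed. *)
Record hmodAlgebra (k : fieldType) (H : hopfAlgebra k) := HModAlgebra {
  hma_mod :> hmodule H;
  amul : hma_mod -> hma_mod -> hma_mod;
  aone : hma_mod;
  hma_algebra : is_algebra amul aone;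
  hact_amul : forall h a b,
    hact h (amul a b) = \ten_(h1, h2 <- cop h) amul (hact h1 a) (hact h2 b);
  hact_aone : forall h, hact h aone = counit h *: aone
}.

(** Objects of [_A(H-Mod)]. *)
Record amodule (k : fieldType) (H : hopfAlgebra k) (A : hmodAlgebra H) := AModule {
  amod_mod :> hmodule H;
  aact : A -> amod_mod -> amod_mod;
  aact_bilin : bilin aact;
  aact1 : forall n, aact (aone A) n = n;
  aactM : forall a b n, aact (amul a b) n = aact a (aact b n);
  hact_aact : forall h a n,
    hact h (aact a n) = \ten_(h1, h2 <- cop h) aact (hact h1 a) (hact h2 n)
}.

(** [B]-[A]-bimodules with a compatible [H]-action. *)
Record hbimodule (k : fieldType) (H : hopfAlgebra k) (B A : hmodAlgebra H) := HBimodule {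
  bimod_mod :> hmodule H;
  lact : B -> bimod_mod -> bimod_mod;
  ract : bimod_mod -> A -> bimod_mod;
  lact_bilin : bilin lact;
  ract_bilin : bilin ract;
  lact1 : forall m, lact (aone B) m = m;
  lactM : forall b c m, lact (amul b c) m = lact b (lact c m);
  ract1 : forall m, ract m (aone A) = m;
  ractM : forall m a c, ract m (amul a c) = ract (ract m a) c;
  lractA : forall b m a, ract (lact b m) a = lact b (ract m a);
  hact_lract : forall h b m a, hact h (ract (lact b m) a) =
    \ten_(h1, h' <- cop h) \ten_(h2, h3 <- cop h')
      ract (lact (hact h1 b) (hact h2 m)) (hact h3 a)
}.

Lemma hact_bilin (k : fieldType) (H : hopfAlgebra k) (M : hmodule H) :
  bilin (@hact k H M).
Proof. by have [] := hact_hmodule M. Qed.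
Lemma hact1 (k : fieldType) (H : hopfAlgebra k) (M : hmodule H) (m : M) :
  hact 1 m = m.
Proof. by have [] := hact_hmodule M. Qed.
Lemma hactM (k : fieldType) (H : hopfAlgebra k) (M : hmodule H) (g h : H) (m : M) :
  hact (g * h) m = hact g (hact h m).
Proof. by have [] := hact_hmodule M. Qed.

Lemma amul_bilin (k : fieldType) (H : hopfAlgebra k) (A : hmodAlgebra H) :
  bilin (@amul k H A).
Proof. by have [] := hma_algebra A. Qed.

Ltac lin :=
  cbv beta;
  lazymatch goal with
  | |- GRing.linear_for _ (fun u => u) => exact: lin_id
  | |- GRing.linear_for _ (fun u => @tev ?k ?V ?W ?R ?ra ?la ?U (@?b u) (@?f u)) =>
      lazymatch f with
      | fun _ => ?x => refine (@tev_param_linear k V W R ra la _ U b x _) => ? ?; lin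
      | _ => lazymatch b with fun _ => ?c =>
          refine (@lin_comp _ _ _ _ (@tev k V W R ra la U c) f _ _);
          [apply: tev_linear; [bil | try by []] | lin] end
      end
  | |- GRing.linear_for _ (fun u => @tpure ?k ?V ?W ?R ?ra ?la (@?f u) (@?g u)) =>
      lin2 (@tpure k V W R ra la) (@tpure_bilin k V W R ra la) f g
  | |- GRing.linear_for _ (fun u => @hact ?k ?H ?M (@?f u) (@?g u)) =>
      lin2 (@hact k H M) (@hact_bilin k H M) f g
  | |- GRing.linear_for _ (fun u => @amul ?k ?H ?A (@?f u) (@?g u)) =>
      lin2 (@amul k H A) (@amul_bilin k H A) f g
  | |- GRing.linear_for _ (fun u => @aact ?k ?H ?A ?N (@?f u) (@?g u)) =>
      lin2 (@aact k H A N) (@aact_bilin k H A N) f g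
  | |- GRing.linear_for _ (fun u => @lact ?k ?H ?B ?A ?M (@?f u) (@?g u)) =>
      lin2 (@lact k H B A M) (@lact_bilin k H B A M) f g
  | |- GRing.linear_for _ (fun u => @ract ?k ?H ?B ?A ?M (@?f u) (@?g u)) =>
      lin2 (@ract k H B A M) (@ract_bilin k H B A M) f g
  | |- GRing.linear_for _ (fun u => @GRing.mul _ (@?f u) (@?g u)) =>
      lazymatch f with
      | fun _ => ?c =>
        refine (@lin_comp _ _ _ _ (fun z => c * z) g _ _); [exact: (mul_bilin _).2 | lin]
      | _ => lazymatch g with fun _ => ?c =>
        refine (@lin_comp _ _ _ _ (fun z => z * c) f _ _); [exact: (mul_bilin _).1 | lin] end
      end
  | |- GRing.linear_for _ (fun u => @cop ?k ?H (@?f u)) =>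
      refine (@lin_comp _ _ _ _ (@cop k H) f (@cop_linear k H) _); lin
  | |- GRing.linear_for _ (fun u => _) => fail "lin"
  | |- GRing.linear_for _ ?f => change f with (fun u => f u); lin
  end
with bil := split => ? ; lin
with lin2 op pf f g :=
  lazymatch f with
  | fun _ => ?c => refine (@lin_comp _ _ _ _ (op c) g (proj2 pf c) _); lin
  | _ => lazymatch g with fun _ => ?c =>
      refine (@lin_comp _ _ _ _ (fun z => op z c) f (proj1 pf c) _); lin end
  end.

Section Smash.
Variables (k : fieldType) (H : hopfAlgebra k) (A : hmodAlgebra H).

(** The product of the smash product [A # H], on the vector space [A ⊗ H]. *)
Definition smash_mul (x y : (A ⊗ H)%type) : (A ⊗ H)%type :=
  \ten_(a, g <- x) \ten_(b, h <- y) \ten_(g1, g2 <- cop g)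
    amul a (hact g1 b) ⊗ (g2 * h).

Definition in_centraliser (x : (A ⊗ H)%type) : Prop :=
  forall b : A, smash_mul x (b ⊗ 1) = smash_mul (b ⊗ 1) x.

Lemma smash_linl y : linear (smash_mul^~ y).
Proof. by rewrite /smash_mul; lin. Qed.
Lemma smash_linr x : linear (smash_mul x).
Proof. by rewrite /smash_mul; lin. Qed.

Definition centr_pred : {pred (A ⊗ H)%type} := fun x => `[< in_centraliser x >].

Lemma centr_submod : submod_closed centr_pred.
Proof.
split.
  apply/asboolP => b; have l0 (f : (A ⊗ H)%type -> (A ⊗ H)%type) : linear f -> f 0 = 0.
    by move=> lf; have := lf (-1) 0 0; rewrite scaler0 addr0 scaleN1r addNr.
  by rewrite (l0 _ (smash_linl _)) (l0 _ (smash_linr _)).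
move=> a x y /asboolP cx /asboolP cy; apply/asboolP => b.
by rewrite smash_linl smash_linr cx cy.
Qed.
HB.instance Definition _ := GRing.isSubmodClosed.Build k (A ⊗ H)%type centr_pred centr_submod.

(** The centraliser of [A] in [A # H], as a subspace. *)
Record centraliser := Centraliser { cval :> (A ⊗ H)%type; _ : cval \in centr_pred }.
HB.instance Definition _ := [isSub for cval].
HB.instance Definition _ := [Choice of centraliser by <:].
HB.instance Definition _ := [SubChoice_isSubLmodule of centraliser by <:].

Lemma cvalP (x : centraliser) : in_centraliser (cval x).
Proof. by apply/asboolP; case: x. Qed.
End Smash.


(** The vector space [H ⊗ A] is an algebra for [tensor_mul] and a Yetter-Drinfeld
    module for [h (u ⊗ a) = h1 u S(h3) ⊗ h2 a] and [u ⊗ a |-> u1 ⊗ (u2 ⊗ a)].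
    [centr_act] and [centr_coact] transport this structure to [A ⊗ H] along
    [centr_embed], which maps the centraliser onto the full centre of [A], that
    is the space of the [u ⊗ a] such that [u ⊗ ab = u1 ⊗ u2(b) a] for all [b].
    This needs [S(h) ⊗ a] and not [S^-1(h) ⊗ a] in [centr_embed]: the action
    transported along the latter does not preserve the centraliser, for instance,
    when [H] is Sweedler's algebra with [c] group-like, [cop x = x ⊗ 1 + c ⊗ x],
    and [A = k[t]/(t^2)] with [c t = -t], [x t = 1]. *)
Section CentraliserFormulas.
Variables (k : fieldType) (H : hopfAlgebra k) (A : hmodAlgebra H).

Definition tensor_mul (x y : (H ⊗ A)%type) : (H ⊗ A)%type :=
  \ten_(g, a <- x) \ten_(h, b <- y) (g * h) ⊗ amul a b.

Definition centr_embed (x : (A ⊗ H)%type) : (H ⊗ A)%type :=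
  \ten_(a, h <- x) antipode h ⊗ a.

Definition centr_act (h : H) (x : (A ⊗ H)%type) : (A ⊗ H)%type :=
  \ten_(a, g <- x) \ten_(h1, h' <- cop h) \ten_(h2, h3 <- cop h')
    hact h2 a ⊗ (h3 * g * antipodeV h1).

Definition centr_coact (x : (A ⊗ H)%type) : (H ⊗ (A ⊗ H))%type :=
  \ten_(a, g <- x) \ten_(g1, g2 <- cop g) antipode g2 ⊗ (a ⊗ g1).
End CentraliserFormulas.

(** * Algebras in the category of Yetter-Drinfeld modules *)

(** Candidate action, coaction, product and unit of an algebra in [YD(H)]. *)
Record ydData (k : fieldType) (H : hopfAlgebra k) (C : lmodType k) := YDData {
  yact : H -> C -> C;
  ycoact : C -> (H ⊗ C)%type;
  ymul : C -> C -> C;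
  yone : C
}.

Section YetterDrinfeld.
Variables (k : fieldType) (H : hopfAlgebra k).

Definition is_comodule (C : lmodType k) (coact : C -> (H ⊗ C)%type) : Prop :=
  [/\ linear coact,
      forall m, \ten_(h, m0 <- coact m) \ten_(h1, h2 <- cop h) h1 ⊗ (h2 ⊗ m0) =
                \ten_(h1, m1 <- coact m) \ten_(h2, m0 <- coact m1) h1 ⊗ (h2 ⊗ m0)
    & forall m, \ten_(h, m0 <- coact m) counit h *: m0 = m].

Definition is_yd_module (C : lmodType k) (act : H -> C -> C)
    (coact : C -> (H ⊗ C)%type) : Prop :=
  [/\ is_hmodule act, is_comodule coact
    & forall h m,
      \ten_(h1, h2 <- cop h) \ten_(u, m0 <- coact m) (h1 * u) ⊗ act h2 m0 =
      \ten_(h1, h2 <- cop h) \ten_(u, m0 <- coact (act h1 m)) (u * h2) ⊗ m0].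

Definition is_yd_algebra (C : lmodType k) (s : ydData H C) : Prop :=
  [/\ is_yd_module (yact s) (ycoact s) /\ is_algebra (ymul s) (yone s),
      forall h x y, yact s h (ymul s x y) =
        \ten_(h1, h2 <- cop h) ymul s (yact s h1 x) (yact s h2 y),
      forall h, yact s h (yone s) = counit h *: yone s,
      forall x y, ycoact s (ymul s x y) =
        \ten_(u, x0 <- ycoact s x) \ten_(v, y0 <- ycoact s y) (u * v) ⊗ ymul s x0 y0
    & ycoact s (yone s) = 1 ⊗ yone s].

Definition yd_commutative (C : lmodType k) (s : ydData H C) : Prop :=
  forall x y, ymul s x y = \ten_(u, x0 <- ycoact s x) ymul s (yact s u y) x0.

Definition yd_isomorphic (C D : lmodType k) (s : ydData H C) (t : ydData H D) : Prop :=
  exists f : C -> D,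
  [/\ linear f /\ bijective f,
      forall h x, f (yact s h x) = yact t h (f x),
      forall x, ycoact t (f x) = \ten_(u, x0 <- ycoact s x) u ⊗ f x0,
      forall x y, f (ymul s x y) = ymul t (f x) (f y)
    & f (yone s) = yone t].

(** [s] is the structure that the centraliser inherits from the formulas above. It
    is unique, as [cval], its tensor product with [H] and [centr_embed] are
    injective. Its product is the opposite of the one of the smash product. *)
Definition is_centraliser_yd (A : hmodAlgebra H) (s : ydData H (centraliser A)) : Prop :=
  [/\ forall h x, cval (yact s h x) = centr_act h (cval x),
      forall x, \ten_(u, y <- ycoact s x) u ⊗ cval y = centr_coact (cval x),
      forall x y, centr_embed (cval (ymul s x y)) =
        tensor_mul (centr_embed (cval x)) (centr_embed (cval y))
    & centr_embed (cval (yone s)) = 1 ⊗ aone A].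
End YetterDrinfeld.

(** * Categories and equivalences *)

Record category := Category {
  ob :> Type;
  mor : ob -> ob -> Type;
  idm : forall x, mor x x;
  cmp : forall x y z, mor y z -> mor x y -> mor x z;
  cmp1m : forall x y (f : mor x y), cmp (idm y) f = f;
  cmpm1 : forall x y (f : mor x y), cmp f (idm x) = f;
  cmpA : forall x y z t (h : mor z t) (g : mor y z) (f : mor x y),
    cmp h (cmp g f) = cmp (cmp h g) f
}.

Record functor (C D : category) := Functor {
  fob :> C -> D;
  fmor : forall x y : C, mor x y -> mor (fob x) (fob y);
  fmor1 : forall x, fmor (idm x) = idm (fob x);
  fmorM : forall x y z (g : mor y z) (f : mor x y), fmor (cmp g f) = cmp (fmor g) (fmor f)
}.

Definition fid (C : category) : functor C C :=
  @Functor C C id (fun _ _ f => f) (fun=> erefl) (fun _ _ _ _ _ => erefl).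

Section FunctorComposition.
Variables (C D E : category) (G : functor D E) (F : functor C D).
Let gf (x y : C) (f : mor x y) := fmor G (fmor F f).

Lemma fcomp1 x : gf (idm x) = idm (G (F x)).
Proof. by rewrite /gf !fmor1. Qed.
Lemma fcompM x y z (g : mor y z) (f : mor x y) : gf (cmp g f) = cmp (gf g) (gf f).
Proof. by rewrite /gf !fmorM. Qed.

Definition fcomp : functor C E := Functor fcomp1 fcompM.
End FunctorComposition.

Definition is_iso (C : category) (x y : C) (f : mor x y) : Prop :=
  exists g : mor y x, cmp g f = idm x /\ cmp f g = idm y.

Definition nat_isomorphic (C D : category) (F G : functor C D) : Prop :=
  exists eta : forall x, mor (F x) (G x),
    (forall x y (f : mor x y), cmp (eta y) (fmor F f) = cmp (fmor G f) (eta x)) /\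
    forall x, is_iso (eta x).

Definition is_equivalence (C D : category) (F : functor C D) : Prop :=
  exists G : functor D C,
    nat_isomorphic (fcomp G F) (fid C) /\ nat_isomorphic (fcomp F G) (fid D).

Section ModuleCategory.
Variables (k : fieldType) (H : hopfAlgebra k) (A : hmodAlgebra H).

Definition amod_morph (N P : amodule A) (f : N -> P) : Prop :=
  [/\ linear f, forall h n, f (hact h n) = hact h (f n)
    & forall a n, f (aact a n) = aact a (f n)].

Definition amod_mor (N P : amodule A) := {f : N -> P | amod_morph f}.

Lemma amod_id_subproof (N : amodule A) : @amod_morph N N id.
Proof. by []. Qed.
Definition amod_id (N : amodule A) : amod_mor N N := exist _ id (amod_id_subproof N).

Lemma amod_cmp_subproof (N P Q : amodule A) (g : amod_mor P Q) (f : amod_mor N P) :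
  amod_morph (sval g \o sval f).
Proof.
case: g f => g [/= lg hg ag] [f [/= lf hf af]]; split=> /=.
- exact: lin_comp.
- by move=> h n; rewrite hf hg.
- by move=> a n; rewrite af ag.
Qed.
Definition amod_cmp (N P Q : amodule A) (g : amod_mor P Q) (f : amod_mor N P) :
  amod_mor N Q := exist _ (sval g \o sval f) (amod_cmp_subproof g f).

Lemma amod_mor_eq (N P : amodule A) (f g : amod_mor N P) :
  (forall n, sval f n = sval g n) -> f = g.
Proof.
case: f g => f pf [g pg] /= fg; have {}fg : f = g by apply: funext.
by subst g; congr exist; apply: Prop_irrelevance.
Qed.

Lemma amod_cmp1m (N P : amodule A) (f : amod_mor N P) : amod_cmp (amod_id P) f = f.
Proof. exact: amod_mor_eq. Qed.
Lemma amod_cmpm1 (N P : amodule A) (f : amod_mor N P) : amod_cmp f (amod_id N) = f.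
Proof. exact: amod_mor_eq. Qed.
Lemma amod_cmpA (N P Q T : amodule A) (h : amod_mor Q T) (g : amod_mor P Q)
  (f : amod_mor N P) : amod_cmp h (amod_cmp g f) = amod_cmp (amod_cmp h g) f.
Proof. exact: amod_mor_eq. Qed.

(** The category [_A(H-Mod)]. *)
Definition amodCat : category := Category amod_cmp1m amod_cmpm1 amod_cmpA.
End ModuleCategory.

(** * The functor [M (x)_A -] *)

Section TensorFunctor.
Variables (k : fieldType) (H : hopfAlgebra k) (B A : hmodAlgebra H).
Variable M : hbimodule B A.

Lemma hact_lact h b (m : M) :
  hact h (lact b m) = \ten_(h1, h2 <- cop h) lact (hact h1 b) (hact h2 m).
Proof.
rewrite -[lact b m]ract1 hact_lract; apply: eq_tev => h1 h'.
have l : linear (fun g : H => lact (hact h1 b) (hact g m)) by lin.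
rewrite -[in RHS](counitr h') (lin_tev _ _ l); apply: eq_tev => h2 h3.
by rewrite (lin_scale l) hact_aone (lin_scale ((ract_bilin M).2 _)) ract1.
Qed.

Lemma hact_ract h (m : M) a :
  hact h (ract m a) = \ten_(h1, h2 <- cop h) ract (hact h1 m) (hact h2 a).
Proof.
rewrite -[m in LHS]lact1 hact_lract.
rewrite (@copA3 _ _ _ (fun h1 h2 h3 => ract (lact (hact h1 (aone B)) (hact h2 m)) (hact h3 a)));
  try by move=> ? ?; lin.
apply: eq_tev => h' h3.
have l : linear (fun g : H => ract (hact g m) (hact h3 a)) by lin.
rewrite -[in RHS](counitl h') (lin_tev _ _ l); apply: eq_tev => h1 h2.
rewrite (lin_scale l) hact_aone (lin_scale ((lact_bilin M).1 _)) lact1.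
by rewrite (lin_scale ((ract_bilin M).1 _)).
Qed.

Section Object.
Variable N : amodule A.

Local Notation MN := (tens (@ract k H B A M) (@aact k H A N)).
Local Notation pure := (@tpure k M N A (@ract k H B A M) (@aact k H A N)).

(** The actions on [M (x)_A N] are [h (m (x) n) = h1 m (x) h2 n] and
    [b (m (x) n) = b m (x) n]. *)
Definition tens_hact (h : H) (x : MN) : MN :=
  \ten_(m, n <- x) \ten_(h1, h2 <- cop h) pure (hact h1 m) (hact h2 n).
Definition tens_aact (b : B) (x : MN) : MN := \ten_(m, n <- x) pure (lact b m) n.

Lemma tens_hact_bal h m a n :
  \ten_(h1, h2 <- cop h) pure (hact h1 (ract m a)) (hact h2 n) =
  \ten_(h1, h2 <- cop h) pure (hact h1 m) (hact h2 (aact a n)).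
Proof.
transitivity (\ten_(h', h3 <- cop h) \ten_(h1, h2 <- cop h')
    pure (ract (hact h1 m) (hact h2 a)) (hact h3 n)).
  apply: eq_tev => h' h3; rewrite hact_ract.
  have l : linear (fun y => pure y (hact h3 n)) by lin.
  by rewrite (lin_tev _ _ l).
rewrite -(@copA3 _ _ _ (fun h1 h2 h3 => pure (ract (hact h1 m) (hact h2 a)) (hact h3 n)));
  try by move=> ? ?; lin.
apply: eq_tev => h1 h'; rewrite hact_aact.
have l : linear (pure (hact h1 m)) by lin.
by rewrite (lin_tev _ _ l); apply: eq_tev => h2 h3; rewrite tpure_bal.
Qed.

Lemma tens_hact_pure h m n : tens_hact h (pure m n) =
  \ten_(h1, h2 <- cop h) pure (hact h1 m) (hact h2 n).
Proof. by rewrite /tens_hact tev_pure //; [bil | apply: tens_hact_bal]. Qed.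

Lemma tens_aact_bal b m a n : pure (lact b (ract m a)) n = pure (lact b m) (aact a n).
Proof. by rewrite -lractA tpure_bal. Qed.

Lemma tens_aact_pure b m n : tens_aact b (pure m n) = pure (lact b m) n.
Proof. by rewrite /tens_aact tev_pure //; [bil | apply: tens_aact_bal]. Qed.

Lemma tens_hact_bilin : bilin tens_hact.
Proof.
split=> [x|h]; rewrite /tens_hact; first by lin.
by apply: tev_linear; [bil | apply: tens_hact_bal].
Qed.

Lemma tens_aact_bilin : bilin tens_aact.
Proof.
split=> [x|b]; rewrite /tens_aact; first by lin.
by apply: tev_linear; [bil | apply: tens_aact_bal].
Qed.

Lemma tens_hact_hmodule : is_hmodule tens_hact.
Proof.
have lh h := tens_hact_bilin.2 h.
split; first exact: tens_hact_bilin.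
  apply: (@tens_ext _ _ _ _ _ _ _ _ id) => // m n.
  by rewrite tens_hact_pure cop1 tev_pure ?hact1 //; bil.
move=> g h; apply: tens_ext => //; first by apply: lin_comp.
move=> m n; rewrite !tens_hact_pure copM (lin_tev _ _ (lh g)).
pose F (t : (H ⊗ H)%type) := \ten_(h1, h2 <- t) pure (hact h1 m) (hact h2 n).
have lF : linear F by rewrite /F; lin.
rewrite -/(F _) (lin_tev _ _ lF).
under eq_tev do rewrite (lin_tev _ _ lF).
rewrite tevC; apply: eq_tev => h1 h2; rewrite tens_hact_pure.
by apply: eq_tev => g1 g2; rewrite /F tev_pure ?hactM //; bil.
Qed.

Definition tens_hmod : hmodule H := HModule tens_hact_hmodule.

Lemma tens_aact1 (x : tens_hmod) : tens_aact (aone B) x = x.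
Proof.
move: x; apply: (@tens_ext _ _ _ _ _ _ _ _ id) => //; first exact: tens_aact_bilin.2.
by move=> m n; rewrite tens_aact_pure lact1.
Qed.

Lemma tens_aactM b c (x : tens_hmod) :
  tens_aact (amul b c) x = tens_aact b (tens_aact c x).
Proof.
have la b' := tens_aact_bilin.2 b'.
move: x; apply: tens_ext => //; first by apply: lin_comp.
by move=> m n; rewrite !tens_aact_pure lactM.
Qed.

Lemma tens_hact_aact h b (x : tens_hmod) : tens_hact h (tens_aact b x) =
  \ten_(h1, h2 <- cop h) tens_aact (hact h1 b) (tens_hact h2 x).
Proof.
have la b' := tens_aact_bilin.2 b'; have lh h' := tens_hact_bilin.2 h'.
move: x; apply: tens_ext; first by apply: lin_comp.
  by apply: (@tev_param_linear _ _ _ _ _ _ _ _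
    (fun x h1 h2 => tens_aact (hact h1 b) (tens_hact h2 x))) => h1 h2; apply: lin_comp.
move=> m n; rewrite tens_aact_pure tens_hact_pure.
transitivity (\ten_(h', h3 <- cop h) \ten_(h1, h2 <- cop h')
    pure (lact (hact h1 b) (hact h2 m)) (hact h3 n)).
  apply: eq_tev => h' h3; rewrite hact_lact.
  have l : linear (fun y => pure y (hact h3 n)) by lin.
  by rewrite (lin_tev _ _ l).
rewrite -(@copA3 _ _ _ (fun h1 h2 h3 => pure (lact (hact h1 b) (hact h2 m)) (hact h3 n)));
  try by move=> ? ?; lin.
apply: eq_tev => h1 h'; rewrite tens_hact_pure (lin_tev _ _ (la _)).
by apply: eq_tev => h2 h3; rewrite tens_aact_pure.
Qed.

Definition tens_amod : amodule B :=
  @AModule k H B tens_hmod tens_aact tens_aact_bilin tens_aact1 tens_aactM tens_hact_aact.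
End Object.

Section Morphism.
Variables (N P : amodule A) (f : amod_mor N P).

Definition tens_fun (x : tens_amod N) : tens_amod P :=
  \ten_(m, n <- x) tpure (@ract k H B A M) (@aact k H A P) m (sval f n).

Let lf : linear (sval f). Proof. by case: f => g []. Qed.

Lemma tens_fun_pure m n : tens_fun (tpure _ _ m n) = tpure _ _ m (sval f n).
Proof.
rewrite /tens_fun tev_pure //; first by split=> [n'|m']; [lin | apply: lin_comp => //; lin].
by move=> m' a n'; case: f => g [_ _ /= ->]; rewrite tpure_bal.
Qed.

Lemma tens_fun_morph : amod_morph tens_fun.
Proof.
have lt : linear tens_fun.
  apply: tev_linear; first by split=> [n'|m']; [lin | apply: lin_comp => //; lin].
  by move=> m' a n'; case: f => g [_ _ /= ->]; rewrite tpure_bal.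
split=> // [h | b].
  apply: tens_ext; first exact: lin_comp lt ((@tens_hact_bilin N).2 h).
    exact: lin_comp ((@tens_hact_bilin P).2 h) lt.
  move=> m n; rewrite tens_fun_pure /= !tens_hact_pure (lin_tev _ _ lt).
  apply: eq_tev => h1 h2; rewrite tens_fun_pure.
  by case: f => g [_ /= -> _].
apply: tens_ext; first exact: lin_comp lt ((@tens_aact_bilin N).2 b).
  exact: lin_comp ((@tens_aact_bilin P).2 b) lt.
by move=> m n; rewrite tens_fun_pure /= !tens_aact_pure tens_fun_pure.
Qed.

Definition tens_mor : amod_mor (tens_amod N) (tens_amod P) := exist _ _ tens_fun_morph.
End Morphism.

Lemma tens_mor1 (N : amodCat A) : tens_mor (idm N) = amod_id (tens_amod N).
Proof.
apply: amod_mor_eq; have [l _ _] := tens_fun_morph (amod_id N).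
apply: (@tens_ext _ _ _ _ _ _ _ _ id) => // m n; exact: tens_fun_pure.
Qed.

Lemma tens_morM (N P Q : amodCat A) (g : mor P Q) (f : mor N P) :
  tens_mor (cmp g f) = amod_cmp (tens_mor g) (tens_mor f).
Proof.
apply: amod_mor_eq; have [lgf _ _] := tens_fun_morph (cmp g f).
have [lg _ _] := tens_fun_morph g; have [lf _ _] := tens_fun_morph f.
apply: tens_ext => //; first exact: lin_comp lg lf.
by move=> m n; rewrite /= !tens_fun_pure.
Qed.

Definition tensor_functor : functor (amodCat A) (amodCat B) :=
  @Functor (amodCat A) (amodCat B) tens_amod tens_mor tens_mor1 tens_morM.
End TensorFunctor.

(* Main.v *)
(** Transported along [centr_embed], the centraliser of [A] is the full centre [Z(A)],
    a subspace of the Yetter-Drinfeld algebra [H ⊗ A], from which it inherits all its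
    structure; on [Z(A)] the braided opposite product, which is
    [u ⊗ a, y |-> u1 v ⊗ u2(b) a] for [y = v ⊗ b], agrees with the product.

    For a bimodule [M] as in the theorem, relate [z = u ⊗ a] in [H ⊗ A] and
    [w = v ⊗ b] in [H ⊗ B] when [v ⊗ b m = u1 ⊗ u2(m) a] for all [m]; then [Z(A)] is the
    set of the [z] related to themselves through the regular bimodule. The relation is
    compatible with all the structure, and it is equivalent to
    [u ⊗ m a = v1 ⊗ b S^-1(v2)(m)]. The equivalence of categories gives [B = End(M_A)] and
    [A^op = End(_B M)], for all linear endomorphisms and not only the [H]-linear ones,
    because [N ⊗ X] is an object of [_A(H-Mod)] for every [H]-module [X]. As
    [m |-> u(m) a] is right [A]-linear for [z] in [Z(A)], and [m |-> b S^-1(v)(m)] is left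
    [B]-linear for [w] in [Z(B)], the relation is then a bijection from [Z(A)] to [Z(B)]. *)
Require Import Defs.
From mathcomp Require Import all_boot all_algebra.
From mathcomp Require Import boolp classical_sets.

Set Implicit Arguments.
Unset Strict Implicit.
Unset Printing Implicit Defensive.

Import GRing.Theory.
Local Open Scope ring_scope.

(** * Linear algebra over a field *)

(** The spaces may be infinite-dimensional, and linear forms on [H] replace a basis: an element of
    [H ⊗ V] is determined by its images under all forms and rebuilt from finitely many of them.
    Stability under a coaction thus becomes stability under [coslice phi], and an element of [H ⊗ B]
    or [H ⊗ A] is found one slice at a time.

    Elements of [H ⊗ A] and [H ⊗ B] are handled as operators on [H ⊗ M], where the Yetter-Drinfeld
    action is conjugation. The centre is the case of the regular bimodule, so its closure properties
    are instances of those of the relation.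

    The obstacle is that fullness only concerns [H]-linear maps. A left [B]-linear [t] is brought
    under it by its conjugates [h2 t(S^-1(h1) m)], which are equivariant jointly in [m] and [h]; [t]
    is the one at [h = 1]. This order of the legs makes those that act on a scalar [b] adjacent, so
    that they cancel. On the other side the equivalence only supplies [N] with [M ⊗_A N] isomorphic
    to [B]; the pairing of [N] and [M] into [A], which completes a Morita context, is again drawn
    from fullness. *)

Section LinearForms.
Variables (k : fieldType) (V : lmodType k).

(** Zorn's lemma gives a maximal subspace [U] that contains [P] and misses [h]. Maximality makes it
    a complement of the line of [h], and [phi v] is the coefficient of [h] in [v]. *)
Lemma separating_form (P : V -> Prop) (h : V) :
  P 0 -> (forall a u v, P u -> P v -> P (a *: u + v)) -> ~ P h ->
  exists phi : V -> k, [/\ scalar phi, forall v, P v -> phi v = 0 & phi h = 1].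
Proof.
move=> P0 Plin Ph.
(* Closure is asked of the union of [P] and [A], so that the empty chain, whose union is empty,
   satisfies [Q] too. *)
pose Q (A : set V) := (forall a u v, P u \/ A u -> P v \/ A v ->
  P (a *: u + v) \/ A (a *: u + v)) /\ ~ A h.
have [F FQ totF|A [[Alin Ah] maxA]] := @Zorn_bigcup V Q.
  split=> [a u v|[X FX Xh]]; last by have [_] := FQ X FX; apply.
  have mono X Y w : (X `<=` Y)%classic -> P w \/ X w -> P w \/ Y w.
    by move=> XY [?|/XY ?]; [left|right].
  have up X : F X -> forall w, P w \/ X w -> P w \/ (\bigcup_(X in F) X)%classic w.
    by move=> FX w [?|Xw]; [left|right; exists X].
  move=> [Pu|[X FX Xu]] [Pv|[Y FY Yv]].
  - by left; apply: Plin.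
  - by apply: (up Y) => //; apply: (FQ Y FY).1; [left|right].
  - by apply: (up X) => //; apply: (FQ X FX).1; [right|left].
  - have [XY|YX] := totF _ _ FX FY.
      by apply: (up Y) => //; apply: (FQ Y FY).1; right=> //; apply: XY.
    by apply: (up X) => //; apply: (FQ X FX).1; right=> //; apply: YX.
pose U v := P v \/ A v.
have U0 : U 0 by left.
have UZ a u : U u -> U (a *: u) by move=> Uu; rewrite -[_ *: _]addr0; apply: Alin.
have Uh : ~ U h by case.
have Ucoef v : exists c, U (v - c *: h).
  have [Uv|nUv] := pselect (U v); first by exists 0; rewrite scale0r subr0.
  (* The span of [U] and [v]. It is strictly larger than [A], so maximality forces [h] into it. *)
  pose B : set V := fun w => exists u d, U u /\ w = u + d *: v.
  have BA u : U u -> B u by move=> Uu; exists u, 0; rewrite scale0r addr0.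
  have UB w : P w \/ B w -> B w by case=> // Pw; apply: BA; left.
  have Blin a x y : B x -> B y -> B (a *: x + y).
    move=> [u [d [Uu ->]]] [u' [d' [Uu' ->]]]; exists (a *: u + u'), (a * d + d').
    by split; [apply: Alin | rewrite scalerDr scalerDl scalerA addrACA].
  have AB : (A `<` B)%classic.
    split=> [w Aw|BsubA]; first by apply: BA; right.
    by apply: nUv; right; apply: BsubA; exists 0, 1; rewrite scale1r add0r.
  have [[u [d [Uu hud]]]|nBh] := pselect (B h); last first.
    by case: (maxA B AB); split=> // a x y /UB Bx /UB By; right; apply: Blin.
  have [d0|d0] := eqVneq d 0; first by case: Uh; rewrite hud d0 scale0r addr0.
  exists d^-1; rewrite hud scalerDr scalerA mulVf // scale1r opprD addrCA subrr addr0.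
  by rewrite -scalerN; apply: (UZ); rewrite -scaleN1r; apply: (UZ).
have Uuniq c c' v : U (v - c *: h) -> U (v - c' *: h) -> c = c'.
  move=> Uc Uc'; apply: contrapT => /eqP cc'; apply: Uh.
  have d0 : c' - c != 0 by rewrite subr_eq0 eq_sym.
  have -> : h = (c' - c)^-1 *: (-1 *: (v - c' *: h) + (v - c *: h)).
    rewrite scaleN1r opprB addrA subrK -scalerBl scalerA mulVf // scale1r //.
  by apply: (UZ); apply: (Alin).
have [phi phiP] := choice Ucoef; exists phi; split.
- move=> a u v; apply: (Uuniq _ _ (a *: u + v)) => //.
  have -> : a *: u + v - (a * phi u + phi v) *: h =
      a *: (u - phi u *: h) + (v - phi v *: h).
    by rewrite scalerBr scalerDl scalerA opprD addrACA.
  exact: Alin (phiP u) (phiP v).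
- by move=> v Pv; apply: (Uuniq _ _ v) => //; rewrite scale0r subr0; left.
- by apply: (Uuniq _ _ h) => //; rewrite scale1r subrr.
Qed.

(** The vectors fixed by the expansion [E] built so far form a subspace. If [h] is outside it, the
    correction [h - E h] is added with a form that vanishes on this subspace and is 1 at [h], so
    earlier expansions are unchanged. *)
Lemma finite_dual_basis (s : seq V) :
  exists l : seq (V * {phi : V -> k | scalar phi}),
    forall v, v \in s -> v = \sum_(p <- l) sval p.2 v *: p.1.
Proof.
elim: s => [|h s [l lP]]; first by exists [::].
pose E v := \sum_(p <- l) sval p.2 v *: p.1.
have lE a u v : E (a *: u + v) = a *: E u + E v.
  rewrite /E scaler_sumr -big_split; apply: eq_bigr => -[e [phi /= lphi]] _.
  by rewrite lphi scalerDl scalerA.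
have [Eh|/eqP Eh] := pselect (h = E h).
  by exists l => v; rewrite inE => /orP [/eqP -> //|/lP].
have [||psi [lpsi psi0 psi1]] := separating_form (P := fun v => v = E v) _ _ (elimN eqP Eh).
- apply: (@addIr _ (E 0)); rewrite add0r.
  by have := lE 1 0 0; rewrite !scale1r addr0.
- by move=> a u v {1}-> {1}->; rewrite lE.
exists ((h - E h, exist _ psi lpsi) :: l) => v; rewrite inE big_cons /=.
case/orP => [/eqP ->|/lP vE]; first by rewrite psi1 scale1r subrK.
by rewrite psi0 // scale0r add0r.
Qed.

End LinearForms.

Lemma lin_scalel (k : fieldType) (U V : lmodType k) (phi : U -> k) (v : V) :
  scalar phi -> linear (fun u => phi u *: v).
Proof. by move=> lphi a x y; rewrite lphi scalerDl scalerA. Qed.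

Lemma lin_scaler (k : fieldType) (V : lmodType k) (c : k) :
  linear (fun v : V => c *: v).
Proof. by move=> a x y; rewrite scalerDr !scalerA mulrC. Qed.

Lemma lin0 (k : fieldType) (U V : lmodType k) (f : U -> V) : linear f -> f 0 = 0.
Proof. by move=> lf; have := lin_scale lf 0 0; rewrite !scale0r. Qed.

Lemma linB (k : fieldType) (U V : lmodType k) (f : U -> V) x y :
  linear f -> f (x - y) = f x - f y.
Proof. by move=> lf; rewrite -scaleN1r addrC lf scaleN1r addrC. Qed.

Lemma scalar_comp (k : fieldType) (U V : lmodType k) (phi : V -> k) (f : U -> V) :
  scalar phi -> linear f -> scalar (fun u => phi (f u)).
Proof. by move=> lphi lf a x y; rewrite lf lphi. Qed.

(** [multilin] proves that an expression is linear in a variable occurring once in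
    it, from the hint databases of linear and bilinear operations. *)
Create HintDb multilin.

Ltac bil0 := solve [assumption | auto with multilin nocore].
Ltac multilin :=
  cbv beta;
  lazymatch goal with
  | |- GRing.linear_for _ (fun u => u) => exact: lin_id
  | |- GRing.linear_for _ (fun u => @tev ?k ?V ?W ?R ?ra ?la ?U (@?b u) (@?f u)) =>
      lazymatch f with
      | fun _ => ?x => refine (@tev_param_linear k V W R ra la _ U b x _) => ? ?; multilin
      | _ => lazymatch b with fun _ => ?c =>
          refine (@lin_comp _ _ _ _ (@tev k V W R ra la U c) f _ _);
          [first [bil0 | apply: tev_linear; [multibil | try by []]] | multilin] end
      end
  | |- GRing.linear_for _ (fun u => @GRing.scale _ _ (@?f u) (@?g u)) =>
      lazymatch f with
      | fun _ => ?c => refine (@lin_comp _ _ _ _ (fun z => c *: z) g _ _);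
          [exact: lin_scaler | multilin]
      | _ => lazymatch g with fun _ => ?v => refine (@lin_scalel _ _ _ f v _); multiscal end
      end
  | |- GRing.linear_for _ (fun u => ?op (@?f u) (@?g u)) =>
      lazymatch f with
      | fun _ => ?c =>
          refine (@lin_comp _ _ _ _ (op c) g _ _);
          [first [bil0 | refine (proj2 (_ : bilin op) c); bil0] | multilin]
      | _ => lazymatch g with fun _ => ?c =>
          refine (@lin_comp _ _ _ _ (fun z => op z c) f _ _);
          [refine (proj1 (_ : bilin op) c); bil0 | multilin] end
      end
  | |- GRing.linear_for _ (fun u => ?op (@?f u)) =>
      refine (@lin_comp _ _ _ _ op f _ _); [bil0 | multilin]
  | |- GRing.linear_for _ (fun u => _) => fail "multilin"
  | |- GRing.linear_for _ ?f => first [bil0 | change f with (fun u => f u); multilin]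
  end
with multibil := split => ? ; multilin
with multiscal :=
  lazymatch goal with
  | |- GRing.linear_for _ (fun u => ?op (@?f u)) =>
      first [bil0 | refine (@scalar_comp _ _ _ op f _ _); [bil0 | multilin]]
  | _ => bil0
  end.

#[export] Hint Extern 1 (bilin _) => exact: tpure_bilin : multilin.
#[export] Hint Extern 1 (bilin _) => exact: hact_bilin : multilin.
#[export] Hint Extern 1 (bilin _) => exact: amul_bilin : multilin.
#[export] Hint Extern 1 (bilin _) => exact: aact_bilin : multilin.
#[export] Hint Extern 1 (bilin _) => exact: lact_bilin : multilin.
#[export] Hint Extern 1 (bilin _) => exact: ract_bilin : multilin.
#[export] Hint Extern 1 (bilin _) => exact: mul_bilin : multilin.
#[export] Hint Extern 1 (GRing.linear_for _ _) => exact: cop_linear : multilin.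
#[export] Hint Extern 1 (GRing.linear_for _ _) => exact: counit_linear : multilin.
#[export] Hint Extern 1 (GRing.linear_for _ _) => exact: antipode_linear : multilin.

(** * Slices of tensors by linear forms *)

Section Slices.
Variables (k : fieldType) (V W : lmodType k).

Definition slice (phi : V -> k) (x : (V ⊗ W)%type) : W := \ten_(v, w <- x) phi v *: w.

Lemma slice_pure phi v w : scalar phi -> slice phi (v ⊗ w) = phi v *: w.
Proof. by move=> lphi; rewrite /slice tev_pure //; multibil. Qed.

Lemma slice_linear phi : scalar phi -> linear (slice phi).
Proof. by move=> lphi; rewrite /slice; multilin. Qed.

(** A dual basis for the first components of one presentation of [x] expands all of them. *)
Lemma slice_basis (x : (V ⊗ W)%type) :
  exists l : seq (V * {phi : V -> k | scalar phi}),
    x = \sum_(p <- l) p.1 ⊗ slice (sval p.2) x.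
Proof.
have [l lP] := finite_dual_basis [seq p.1 | p <- repr x].
have lt (v : V) : linear (tpure (@noactr V) (@noactl W) v) by multilin.
have lt' (w : W) : linear (fun v : V => v ⊗ w) by multilin.
exists l; rewrite {1}[x]tensE.
transitivity (\sum_(p <- repr x) \sum_(q <- l) q.1 ⊗ (sval q.2 p.1 *: p.2)).
  apply: eq_big_seq => p px; rewrite {1}(lP p.1) ?map_f // (lin_sum _ _ (lt' _)).
  by apply: eq_bigr => q _; rewrite (lin_scale (lt' _)) (lin_scale (lt _)).
by rewrite exchange_big; apply: eq_bigr => q _; rewrite -(lin_sum _ _ (lt _)).
Qed.

Lemma slice_inj (x y : (V ⊗ W)%type) :
  (forall phi, scalar phi -> slice phi x = slice phi y) -> x = y.
Proof.
move=> xy; suff: x - y = 0 by move/subr0_eq.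
have [l ->] := slice_basis (x - y); apply: big1 => -[v [phi lphi]] _ /=.
by rewrite (linB _ _ (slice_linear lphi)) xy // subrr (lin0 ((tpure_bilin _ _).2 v)).
Qed.

End Slices.

Lemma slice_map (k : fieldType) (V W W' : lmodType k) (f : W -> W') phi (x : (V ⊗ W)%type) :
  scalar phi -> linear f -> slice phi (\ten_(v, w <- x) v ⊗ f w) = f (slice phi x).
Proof.
move=> lphi lf; rewrite (lin_tev _ _ (slice_linear lphi)) (lin_tev _ _ lf).
by apply: eq_tev => v w; rewrite slice_pure // (lin_scale lf).
Qed.

(** Flatness over a field: slices commute with [f] and separate tensors. *)
Lemma map_tens_inj (k : fieldType) (V W W' : lmodType k) (f : W -> W') :
  linear f -> injective f ->
  injective (fun x : (V ⊗ W)%type => \ten_(v, w <- x) v ⊗ f w).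
Proof.
move=> lf injf x y /= xy; apply: slice_inj => phi lphi; apply: injf.
by rewrite -!slice_map // xy.
Qed.

(* The second legs of the finitely many [cop h] involved lie in the span of a finite
   family [e], and [m := G (e i)] may be taken in the hypothesis for each [i]. *)
Lemma leg_substitution (k : fieldType) (H : hopfAlgebra k) (M P T T' : lmodType k)
    (t : T -> M -> P) (t' : T' -> M -> P) (y : (H ⊗ T)%type) (y' : (H ⊗ T')%type)
    (G : H -> M) : bilin t -> bilin t' -> linear G ->
  (forall m, \ten_(h, u <- y) h ⊗ t u m = \ten_(h, u <- y') h ⊗ t' u m) ->
  \ten_(h, u <- y) \ten_(h1, h2 <- cop h) h1 ⊗ t u (G h2) =
  \ten_(h, u <- y') \ten_(h1, h2 <- cop h) h1 ⊗ t' u (G h2).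
Proof.
move=> bt bt' lG yy'.
pose legs (S : lmodType k) (z : (H ⊗ S)%type) :=
  [seq q.2 | q <- flatten [seq repr (cop p.1) | p <- repr z]].
have [l lP] := finite_dual_basis (legs T y ++ legs T' y').
have expand (S : lmodType k) (z : (H ⊗ S)%type) (s : S -> M -> P) : bilin s ->
    {subset legs S z <= legs T y ++ legs T' y'} ->
    \ten_(h, u <- z) \ten_(h1, h2 <- cop h) h1 ⊗ s u (G h2) =
    \sum_(p <- l) \ten_(g, c <- \ten_(h, u <- z) h ⊗ s u (G p.1))
      \ten_(h1, h2 <- cop g) (sval p.2 h2 *: h1) ⊗ c.
  move=> bs sub.
  transitivity (\sum_(q <- repr z) \sum_(r <- repr (cop q.1)) \sum_(p <- l)
      (sval p.2 r.2 *: r.1) ⊗ s q.2 (G p.1)).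
    apply: eq_big_seq => q qz; apply: eq_big_seq => r rq.
    have ls : linear (fun h2 => r.1 ⊗ s q.2 (G h2)) by multilin.
    rewrite {1}(lP r.2); last first.
      apply/sub/mapP; exists r => //; apply/flatten_mapP; by exists q.
    rewrite (lin_sum _ _ ls); apply: eq_bigr => p _.
    by rewrite (lin_scale ls) (lin_scale ((tpure_bilin _ _).1 _)).
  rewrite [RHS](eq_bigr (fun p => \sum_(q <- repr z) \sum_(r <- repr (cop q.1))
      (sval p.2 r.2 *: r.1) ⊗ s q.2 (G p.1))).
    by rewrite [RHS]exchange_big; apply: eq_bigr => q _; apply: exchange_big.
  move=> [e [phi /= lphi]] _.
  pose F c g := \ten_(h1, h2 <- cop g) (phi h2 *: h1) ⊗ (c : P).
  have bF : bilin (fun g c => F c g) by rewrite /F; multibil.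
  rewrite -/(tev (fun g c => F c g) _) (lin_tev _ _ (tev_linear bF _)) //.
  by apply: eq_bigr => q _; rewrite tev_pure.
rewrite !expand //; last first.
- by move=> g gl; rewrite mem_cat gl.
- by move=> g gl; rewrite mem_cat gl orbT.
by apply: eq_bigr => p _; rewrite yy'.
Qed.

(** * The antipode *)

Section TensorSums.
Variables (k : fieldType) (V W U : lmodType k) (F : V -> W -> U).
Hypothesis bF : bilin F.

Lemma ten_pure v w : \ten_(p, q <- v ⊗ w) F p q = F v w.
Proof. exact: tev_pure. Qed.

Lemma ten_ten (V' W' : lmodType k) (R : Type) (ra : V' -> R -> V') (la : R -> W' -> W')
    (G : V' -> W' -> (V ⊗ W)%type) (x : tens ra la) :
  \ten_(p, q <- \ten_(a, b <- x) G a b) F p q = \ten_(a, b <- x) \ten_(p, q <- G a b) F p q.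
Proof. by rewrite (lin_tev _ _ (tev_linear bF (fun _ _ _ => erefl))). Qed.

Lemma ten_map (V' W' : lmodType k) (R : Type) (ra : V' -> R -> V') (la : R -> W' -> W')
    (c : V' -> W' -> V) (d : V' -> W' -> W) (x : tens ra la) :
  \ten_(p, q <- \ten_(a, b <- x) c a b ⊗ d a b) F p q = \ten_(a, b <- x) F (c a b) (d a b).
Proof. by rewrite ten_ten; apply: eq_tev => a b; apply: ten_pure. Qed.
End TensorSums.

Lemma ten_id (k : fieldType) (V W : lmodType k) (x : (V ⊗ W)%type) :
  \ten_(v, w <- x) v ⊗ w = x.
Proof. by rewrite [RHS]tensE. Qed.

Section HopfIdentities.
Variables (k : fieldType) (H : hopfAlgebra k).
Implicit Types g h : H.

Local Notation S := (@antipode k H).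
Local Notation S' := (@antipodeV k H).

Lemma counitl_lin (U : lmodType k) (f : H -> U) h : linear f ->
  \ten_(h1, h2 <- cop h) counit h1 *: f h2 = f h.
Proof.
move=> lf; rewrite -[in RHS](counitl h) (lin_tev _ _ lf).
by apply: eq_tev => h1 h2; rewrite (lin_scale lf).
Qed.

Lemma counitr_lin (U : lmodType k) (f : H -> U) h : linear f ->
  \ten_(h1, h2 <- cop h) counit h2 *: f h1 = f h.
Proof.
move=> lf; rewrite -[in RHS](counitr h) (lin_tev _ _ lf).
by apply: eq_tev => h1 h2; rewrite (lin_scale lf).
Qed.

Lemma cop1_ten (U : lmodType k) (F : H -> H -> U) : bilin F ->
  \ten_(p, q <- cop 1) F p q = F 1 1.
Proof. by move=> bF; rewrite cop1 ten_pure. Qed.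

Lemma copM_ten (U : lmodType k) (F : H -> H -> U) g h : bilin F ->
  \ten_(p, q <- cop (g * h)) F p q =
  \ten_(g1, g2 <- cop g) \ten_(h1, h2 <- cop h) F (g1 * h1) (g2 * h2).
Proof.
move=> bF; rewrite copM ten_ten //; apply: eq_tev => g1 g2.
exact: ten_map.
Qed.

Section Contraction.
Variable c : H -> H -> H.
Hypothesis (cE : forall h, \ten_(h1, h2 <- cop h) c h1 h2 = (counit h)%:A).

(** [c h1 h2] stands for any of [S(h1) h2], [h1 S(h2)], [S^-1(h2) h1] and [h2 S^-1(h1)], so that the
    four antipode identities are treated at once. *)
Lemma contract (U : lmodType k) (f : H -> U) h : linear f ->
  \ten_(h1, h2 <- cop h) f (c h1 h2) = counit h *: f 1.
Proof. by move=> lf; rewrite -(lin_tev _ _ lf) cE (lin_scale lf). Qed.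

Lemma contract_r (U : lmodType k) (F : H -> H -> U) h : bilin F ->
  \ten_(h1, h' <- cop h) \ten_(h2, h3 <- cop h') F h1 (c h2 h3) = F h 1.
Proof.
move=> bF; rewrite -[RHS](counitr_lin _ (bF.1 1)); apply: eq_tev => h1 h'.
exact: (contract _ (bF.2 h1)).
Qed.

Hypothesis bc : bilin c.

Lemma contract_l (U : lmodType k) (F : H -> H -> U) h : bilin F ->
  \ten_(h1, h' <- cop h) \ten_(h2, h3 <- cop h') F (c h1 h2) h3 = F 1 h.
Proof.
move=> bF; rewrite (@copA3 _ _ _ (fun h1 h2 h3 => F (c h1 h2) h3)); try by move=> ? ?; multilin.
rewrite -[RHS](counitl_lin _ (bF.2 1)); apply: eq_tev => h' h3.
exact: (contract _ (bF.1 h3)).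
Qed.
End Contraction.

Lemma antipode1 : S 1 = 1.
Proof.
have := antipodel (1 : H); rewrite cop1_ten; last by multibil.
by rewrite mulr1 counit1 scale1r.
Qed.

Lemma copA3r (U : lmodType k) (T : H -> H -> H -> U) h :
  (forall y z, linear (fun x => T x y z)) -> (forall x z, linear (fun y => T x y z)) ->
  (forall x y, linear (T x y)) ->
  \ten_(h', h3 <- cop h) \ten_(h1, h2 <- cop h') T h1 h2 h3 =
  \ten_(h1, h' <- cop h) \ten_(h2, h3 <- cop h') T h1 h2 h3.
Proof. by move=> *; rewrite copA3. Qed.

(** Uniqueness of convolution inverses: [S(gh)] is a left inverse and [S(h) S(g)] a right inverse of
    the product of [H]. The sum of [S(g1 h1) g2 h2 S(h3) S(g3)] contracts to either one. *)
Lemma antipodeM g h : S (g * h) = S h * S g.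
Proof.
transitivity (\ten_(g', g3 <- cop g) \ten_(h', h3 <- cop h)
    \ten_(g1, g2 <- cop g') \ten_(h1, h2 <- cop h')
      (S (g1 * h1) * (g2 * h2)) * (S h3 * S g3)); last first.
  rewrite -(counitl_lin g (f := fun x => S h * S x)); last by multilin.
  apply: eq_tev => g' g3.
  rewrite -(counitl_lin h (f := fun x => counit g' *: (S x * S g3))); last by multilin.
  apply: eq_tev => h' h3; rewrite scalerA mulrC -counitM.
  rewrite -[X in _ = _ *: X]mul1r -(contract (@antipodel _ H) (f := fun x => x * (S h3 * S g3)));
    last by multilin.
  by rewrite copM_ten; last by multibil.
under eq_tev => g' g3 do rewrite tevC.
rewrite copA3r; try by move=> ? ?; multilin.
rewrite -[S (g * h)]mulr1.
rewrite -(contract_r (@antipoder _ H) (F := fun x y => S (x * h) * y)); last by multibil.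
apply: eq_tev => g1 g'; apply: eq_tev => g2 g3.
rewrite copA3r; try by move=> ? ?; multilin.
rewrite -[S g3 in LHS]mul1r.
rewrite -(contract_r (@antipoder _ H) (F := fun x y => S (g1 * x) * (g2 * (y * S g3))));
  last by multibil.
by apply: eq_tev => h1 h'; apply: eq_tev => h2 h3; rewrite !mulrA.
Qed.

Lemma antipodeV_linear : linear S'.
Proof.
move=> a g h; apply: (can_inj (@antipodeK _ H)); rewrite antipodeVK.
by symmetry; rewrite [LHS]antipode_linear !antipodeVK.
Qed.

Lemma antipodeVM g h : S' (g * h) = S' h * S' g.
Proof. by apply: (can_inj (@antipodeK _ H)); rewrite antipodeM !antipodeVK. Qed.

Lemma antipodeV1 : S' 1 = 1.
Proof. by rewrite -[1 in LHS]antipode1 antipodeK. Qed.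

(** [S] is injective, reverses products, and sends [S^-1(h2) h1] to [S(h1) h2]. *)
Lemma antipodeVl h : \ten_(h1, h2 <- cop h) S' h2 * h1 = (counit h)%:A.
Proof.
have lS := @antipode_linear _ H.
apply: (can_inj (@antipodeK _ H)); rewrite (lin_tev _ _ lS) (lin_scale lS) antipode1.
by rewrite -antipodel; apply: eq_tev => h1 h2; rewrite antipodeM antipodeVK.
Qed.

Lemma antipodeVr h : \ten_(h1, h2 <- cop h) h2 * S' h1 = (counit h)%:A.
Proof.
have lS := @antipode_linear _ H.
apply: (can_inj (@antipodeK _ H)); rewrite (lin_tev _ _ lS) (lin_scale lS) antipode1.
by rewrite -antipoder; apply: eq_tev => h1 h2; rewrite antipodeM antipodeVK.
Qed.

Definition cop_mul (x y : (H ⊗ H)%type) : (H ⊗ H)%type :=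
  \ten_(x1, x2 <- x) \ten_(y1, y2 <- y) (x1 * y1) ⊗ (x2 * y2).

Lemma cop_mul_bilin : bilin cop_mul.
Proof. by rewrite /cop_mul; split=> ?; multilin. Qed.

Lemma cop_mul_pure g h g' h' : cop_mul (g ⊗ h) (g' ⊗ h') = (g * g') ⊗ (h * h').
Proof. by rewrite /cop_mul !ten_pure //; multibil. Qed.

Lemma cop_mulA : associative cop_mul.
Proof.
have bm := cop_mul_bilin => x y z.
move: x; apply: tens_ext; [by multilin | by multilin |] => x1 x2.
move: y; apply: tens_ext; [by multilin | by multilin |] => y1 y2.
move: z; apply: tens_ext; [by multilin | by multilin |] => z1 z2.
by rewrite !cop_mul_pure !mulrA.
Qed.

Lemma cop_mul1 : left_id (1 ⊗ 1) cop_mul.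
Proof.
have [_ l] := cop_mul_bilin.
apply: (@tens_ext _ _ _ _ _ _ _ _ id) => // x y.
by rewrite cop_mul_pure !mul1r.
Qed.

(** Uniqueness of convolution inverses again, now for [cop] with values in [H ⊗ H]: by [QE] the
    right-hand side is a right inverse, and [cop (S h)] is a left one because [cop] is
    multiplicative. *)
Lemma cop_antipode h : cop (S h) = \ten_(h1, h2 <- cop h) S h2 ⊗ S h1.
Proof.
pose Q g := \ten_(h1, h2 <- cop g) S h2 ⊗ S h1.
have lQ : linear Q by rewrite /Q; multilin.
have bm := cop_mul_bilin.
have QE g : \ten_(h1, h2 <- cop g) cop_mul (cop h1) (Q h2) = counit g *: (1 ⊗ 1).
  transitivity (\ten_(h1, h' <- cop g) \ten_(h2, h'' <- cop h')
      \ten_(h3, h4 <- cop h'') (h1 * S h4) ⊗ (h2 * S h3)).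
    transitivity (\ten_(h', h'' <- cop g) \ten_(h1, h2 <- cop h')
      \ten_(h3, h4 <- cop h'') (h1 * S h4) ⊗ (h2 * S h3)).
      apply: eq_tev => h' h''; rewrite /cop_mul; apply: eq_tev => h1 h2.
      by rewrite /Q ten_map //; multibil.
    by rewrite copA3r //; move=> ? ?; multilin.
  (* The adjacent legs in [h2 S(h3)] cancel first, which brings [h1] and [S(h4)] together. *)
  under eq_tev => h1 h'.
    rewrite (@copA3 _ _ _ (fun h2 h3 h4 => (h1 * S h4) ⊗ (h2 * S h3)));
      try by move=> ? ?; multilin.
    under eq_tev => h2 h3.
      rewrite (contract (@antipoder _ H) (f := fun y => (h1 * S h3) ⊗ y)); last by multilin.
    over.
    rewrite counitl_lin; last by multilin.
  over.
  by rewrite (contract (@antipoder _ H) (f := fun y => y ⊗ 1)); last by multilin.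
rewrite -[RHS]cop_mul1 -/(Q h) -cop1.
rewrite -(contract_l (@antipodel _ H) _ (F := fun x y => cop_mul (cop x) (Q y))); try by multibil.
transitivity (\ten_(h1, h' <- cop h) cop_mul (cop (S h1)) (counit h' *: (1 ⊗ 1))).
  rewrite -[LHS](counitr_lin _ (f := fun x => cop (S x))); last by multilin.
  apply: eq_tev => h1 h2; rewrite (lin_scale (bm.2 _)); congr (_ *: _).
  rewrite /cop_mul -[LHS]ten_id; apply: eq_tev => a b.
  by rewrite ten_pure ?mulr1 //; multibil.
apply: eq_tev => h1 h'; rewrite -QE (lin_tev _ _ (bm.2 _)); apply: eq_tev => h2 h3.
by rewrite cop_mulA /cop_mul -copM.
Qed.

Lemma cop_antipode_ten (U : lmodType k) (F : H -> H -> U) h : bilin F ->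
  \ten_(p, q <- cop (S h)) F p q = \ten_(h1, h2 <- cop h) F (S h2) (S h1).
Proof. by move=> bF; rewrite cop_antipode ten_map. Qed.

Lemma cop_antipodeV_ten (U : lmodType k) (F : H -> H -> U) h : bilin F ->
  \ten_(p, q <- cop (S' h)) F p q = \ten_(h1, h2 <- cop h) F (S' h2) (S' h1).
Proof.
move=> bF; rewrite -[h in RHS]antipodeVK cop_antipode_ten.
  by apply: eq_tev => p q; rewrite !antipodeK.
by have lV := antipodeV_linear; multibil.
Qed.

End HopfIdentities.
#[export] Hint Extern 1 (GRing.linear_for _ _) => exact: antipodeV_linear : multilin.

(** * Actions on [H ⊗ M] *)

Section DiagonalAction.
Variables (k : fieldType) (H : hopfAlgebra k) (V W : lmodType k).
Variables (av : H -> V -> V) (aw : H -> W -> W).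

Definition diag_act (h : H) (x : (V ⊗ W)%type) : (V ⊗ W)%type :=
  \ten_(v, w <- x) \ten_(h1, h2 <- cop h) av h1 v ⊗ aw h2 w.

Hypotheses (avP : is_hmodule av) (awP : is_hmodule aw).

Let bav : bilin av. Proof. by case: avP. Qed.
Let baw : bilin aw. Proof. by case: awP. Qed.

Lemma diag_act_pure h v w : diag_act h (v ⊗ w) = \ten_(h1, h2 <- cop h) av h1 v ⊗ aw h2 w.
Proof. by rewrite /diag_act ten_pure //; multibil. Qed.

Lemma diag_act_hmodule : is_hmodule diag_act.
Proof.
have bd : bilin diag_act by rewrite /diag_act; multibil.
have [_ av1 avM] := avP; have [_ aw1 awM] := awP.
split=> //.
  apply: (@tens_ext _ _ _ _ _ _ _ _ id) => //; first by multilin.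
  by move=> v w; rewrite diag_act_pure cop1_ten ?av1 ?aw1 //; multibil.
move=> g h; apply: tens_ext; [by multilin | by multilin |] => v w.
rewrite !diag_act_pure copM_ten; last by multibil.
rewrite (lin_tev _ _ (bd.2 g)) tevC; apply: eq_tev => h1 h2.
by rewrite diag_act_pure; apply: eq_tev => g1 g2; rewrite avM awM.
Qed.
End DiagonalAction.

Lemma mul_hmodule (k : fieldType) (H : hopfAlgebra k) : is_hmodule (fun g h : H => g * h).
Proof. by split=> [|m|g h m]; [multibil | rewrite mul1r | rewrite mulrA]. Qed.

Definition hreg (k : fieldType) (H : hopfAlgebra k) : hmodule H := HModule (@mul_hmodule k H).

Definition htens (k : fieldType) (H : hopfAlgebra k) (X Y : hmodule H) : hmodule H :=
  HModule (diag_act_hmodule (hact_hmodule X) (hact_hmodule Y)).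

Lemma amulA (k : fieldType) (H : hopfAlgebra k) (A : hmodAlgebra H) :
  associative (@amul k H A).
Proof. by case: (hma_algebra A). Qed.
Lemma amul1a (k : fieldType) (H : hopfAlgebra k) (A : hmodAlgebra H) :
  left_id (aone A) (@amul k H A).
Proof. by case: (hma_algebra A). Qed.
Lemma amula1 (k : fieldType) (H : hopfAlgebra k) (A : hmodAlgebra H) :
  right_id (aone A) (@amul k H A).
Proof. by case: (hma_algebra A). Qed.

Section RegularBimodule.
Variables (k : fieldType) (H : hopfAlgebra k) (A : hmodAlgebra H).

Lemma reg_hact_lract (h : H) (b m a : A) : hact h (amul (amul b m) a) =
  \ten_(h1, h' <- cop h) \ten_(h2, h3 <- cop h') amul (amul (hact h1 b) (hact h2 m)) (hact h3 a).
Proof.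
rewrite -amulA hact_amul; apply: eq_tev => h1 h'.
by rewrite hact_amul (lin_tev _ _ ((amul_bilin _).2 _)); apply: eq_tev => h2 h3; rewrite amulA.
Qed.

Definition regbimod : hbimodule A A :=
  @HBimodule k H A A A (@amul k H A) (@amul k H A) (@amul_bilin k H A) (@amul_bilin k H A)
    (@amul1a k H A) (fun b c m => esym (amulA b c m)) (@amula1 k H A)
    (fun m a c => amulA m a c) (fun b m a => esym (amulA b m a)) reg_hact_lract.

Definition regmod : amodule A :=
  @AModule k H A A (@amul k H A) (@amul_bilin k H A) (@amul1a k H A)
    (fun b c m => esym (amulA b c m)) (@hact_amul k H A).
End RegularBimodule.

(** Elements of [H ⊗ B] and [H ⊗ A] act on [H ⊗ M], where [M] is a [B]-[A]-bimodule:
    [left_op (v ⊗ b) (g ⊗ m) = v g ⊗ b m], and [right_op (u ⊗ a) (g ⊗ m) = u1 g ⊗ u2(m) a]. *)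
Section Operators.
Variables (k : fieldType) (H : hopfAlgebra k) (B A : hmodAlgebra H) (M : hbimodule B A).
Local Notation K := (H ⊗ M)%type.

Definition leg_act (h : H) (x : K) : K := diag_act (fun g h => g * h) (@hact k H M) h x.
Definition leg_ract (x : K) (a : A) : K := \ten_(g, m <- x) g ⊗ ract m a.
Definition leg_mulr (x : K) (g : H) : K := \ten_(h, m <- x) (h * g) ⊗ m.
Definition left_op (w : (H ⊗ B)%type) (x : K) : K :=
  \ten_(v, b <- w) \ten_(g, m <- x) (v * g) ⊗ lact b m.
Definition right_op (z : (H ⊗ A)%type) (x : K) : K :=
  \ten_(u, a <- z) leg_ract (leg_act u x) a.

Lemma leg_act_bilin : bilin leg_act.
Proof. by case: (diag_act_hmodule (@mul_hmodule k H) (hact_hmodule M)). Qed.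
Lemma leg_ract_bilin : bilin leg_ract.
Proof. by rewrite /leg_ract; multibil. Qed.
Lemma leg_mulr_bilin : bilin leg_mulr.
Proof. by rewrite /leg_mulr; multibil. Qed.
Lemma left_op_bilin : bilin left_op.
Proof. by rewrite /left_op; multibil. Qed.
End Operators.
#[export] Hint Extern 1 (bilin _) => exact: leg_act_bilin : multilin.
#[export] Hint Extern 1 (bilin _) => exact: leg_ract_bilin : multilin.
#[export] Hint Extern 1 (bilin _) => exact: leg_mulr_bilin : multilin.
#[export] Hint Extern 1 (bilin _) => exact: left_op_bilin : multilin.

Lemma right_op_bilin (k : fieldType) (H : hopfAlgebra k) (B A : hmodAlgebra H)
  (M : hbimodule B A) : bilin (@right_op k H B A M).
Proof. by rewrite /right_op; multibil. Qed.
#[export] Hint Extern 1 (bilin _) => exact: right_op_bilin : multilin.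

Section OperatorIdentities.
Variables (k : fieldType) (H : hopfAlgebra k) (B A : hmodAlgebra H) (M : hbimodule B A).
Local Notation K := (H ⊗ M)%type.
Implicit Types (x : K) (z : (H ⊗ A)%type) (w : (H ⊗ B)%type) (g h : H).

Lemma leg_act_pure h g (m : M) :
  leg_act h (g ⊗ m) = \ten_(h1, h2 <- cop h) (h1 * g) ⊗ hact h2 m.
Proof. exact: (diag_act_pure (@mul_hmodule k H) (hact_hmodule M)). Qed.

Lemma leg_act1 x : leg_act 1 x = x.
Proof. by case: (diag_act_hmodule (@mul_hmodule k H) (hact_hmodule M)) => _ + _; apply. Qed.

Lemma leg_actM g h x : leg_act (g * h) x = leg_act g (leg_act h x).
Proof. by case: (diag_act_hmodule (@mul_hmodule k H) (hact_hmodule M)) => _ _; apply. Qed.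

Lemma leg_ract_pure g (m : M) a : leg_ract (g ⊗ m) a = g ⊗ ract m a.
Proof. by rewrite /leg_ract ten_pure //; multibil. Qed.

Lemma leg_mulr_pure h (m : M) g : leg_mulr (h ⊗ m) g = (h * g) ⊗ m.
Proof. by rewrite /leg_mulr ten_pure //; multibil. Qed.

Lemma left_op_pure v b g (m : M) : left_op (v ⊗ b) (g ⊗ m) = (v * g) ⊗ lact b m.
Proof. by rewrite /left_op !ten_pure //; multibil. Qed.

Lemma right_op_pure u a x : right_op (u ⊗ a) x = leg_ract (leg_act u x) a.
Proof. by rewrite /right_op ten_pure //; multibil. Qed.

Lemma leg_ractM x a c : leg_ract x (amul a c) = leg_ract (leg_ract x a) c.
Proof.
move: x; apply: tens_ext; [by multilin | by multilin |] => g m.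
by rewrite !leg_ract_pure ractM.
Qed.

Lemma leg_act_ract h x a :
  leg_act h (leg_ract x a) = \ten_(h1, h2 <- cop h) leg_ract (leg_act h1 x) (hact h2 a).
Proof.
move: x; apply: tens_ext; [by multilin | by multilin |] => g m.
rewrite leg_ract_pure leg_act_pure.
transitivity (\ten_(h1, h' <- cop h) \ten_(h2, h3 <- cop h')
    (h1 * g) ⊗ ract (hact h2 m) (hact h3 a)).
  by apply: eq_tev => h1 h'; rewrite hact_ract (lin_tev _ _ ((tpure_bilin _ _).2 _)).
rewrite (@copA3 _ _ _ (fun h1 h2 h3 => (h1 * g) ⊗ ract (hact h2 m) (hact h3 a)));
  try by move=> ? ?; multilin.
apply: eq_tev => h' h3; rewrite leg_act_pure (lin_tev _ _ ((leg_ract_bilin _).1 _)).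
by apply: eq_tev => h1 h2; rewrite leg_ract_pure.
Qed.

Lemma left_op_ract w x a : left_op w (leg_ract x a) = leg_ract (left_op w x) a.
Proof.
move: x; apply: tens_ext; [by multilin | by multilin |] => g m.
move: w; apply: tens_ext; [by multilin | by multilin |] => v b.
by rewrite !(leg_ract_pure, left_op_pure) lractA.
Qed.

Lemma left_op_mulr w x g : left_op w (leg_mulr x g) = leg_mulr (left_op w x) g.
Proof.
move: x; apply: tens_ext; [by multilin | by multilin |] => h m.
move: w; apply: tens_ext; [by multilin | by multilin |] => v b.
by rewrite !(leg_mulr_pure, left_op_pure) mulrA.
Qed.

Lemma right_op_mulr z x g : right_op z (leg_mulr x g) = leg_mulr (right_op z x) g.
Proof.
move: x; apply: tens_ext; [by multilin | by multilin |] => h m.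
move: z; apply: tens_ext; [by multilin | by multilin |] => u a.
rewrite leg_mulr_pure !right_op_pure !leg_act_pure.
rewrite !(lin_tev _ _ ((leg_ract_bilin _).1 _)) (lin_tev _ _ ((leg_mulr_bilin _).1 _)).
by apply: eq_tev => u1 u2; rewrite !(leg_ract_pure, leg_mulr_pure) mulrA.
Qed.

End OperatorIdentities.

Section RegularOperators.
Variables (k : fieldType) (H : hopfAlgebra k) (A : hmodAlgebra H).
Implicit Types x y z : (H ⊗ A)%type.

(** [braided_opposite_mul] identifies this product with the braided opposite of [tensor_mul]. *)
Definition twist_mul z x : (H ⊗ A)%type := right_op (M := regbimod A) z x.

Lemma tensor_mulE z x : tensor_mul z x = left_op (M := regbimod A) z x.
Proof. by []. Qed.

Lemma tensor_mul_bilin : bilin (@tensor_mul k H A).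
Proof. exact: (@left_op_bilin _ _ _ _ (regbimod A)). Qed.
Lemma twist_mul_bilin : bilin twist_mul.
Proof. exact: (@right_op_bilin _ _ _ _ (regbimod A)). Qed.

Lemma tensor_mul_pure (g h : H) (a b : A) : tensor_mul (g ⊗ a) (h ⊗ b) = (g * h) ⊗ amul a b.
Proof. exact: (@left_op_pure _ _ _ _ (regbimod A)). Qed.

Lemma twist_mul_pure (u g : H) (a c : A) : twist_mul (u ⊗ a) (g ⊗ c) =
  \ten_(u1, u2 <- cop u) (u1 * g) ⊗ amul (hact u2 c) a.
Proof.
rewrite /twist_mul right_op_pure leg_act_pure (lin_tev _ _ ((leg_ract_bilin _).1 _)).
by apply: eq_tev => u1 u2; rewrite leg_ract_pure.
Qed.
End RegularOperators.
#[export] Hint Extern 1 (bilin _) => exact: tensor_mul_bilin : multilin.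
#[export] Hint Extern 1 (bilin _) => exact: twist_mul_bilin : multilin.

Section OperatorProducts.
Variables (k : fieldType) (H : hopfAlgebra k) (B A : hmodAlgebra H) (M : hbimodule B A).
Implicit Types (x : (H ⊗ M)%type) (z : (H ⊗ A)%type) (w : (H ⊗ B)%type) (g h : H).

Lemma left_op_mul w w' x : left_op (tensor_mul w w') x = left_op w (left_op w' x).
Proof.
move: x; apply: tens_ext; [by multilin | by multilin |] => g m.
move: w; apply: tens_ext; [by multilin | by multilin |] => v b.
move: w'; apply: tens_ext; [by multilin | by multilin |] => v' b'.
by rewrite tensor_mul_pure !left_op_pure lactM mulrA.
Qed.

Lemma leg_ract_right_op z x c :
  leg_ract (right_op z x) c = right_op (tensor_mul z (1 ⊗ c)) x.
Proof.
move: z; apply: tens_ext; [by multilin | by multilin |] => u a.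
by rewrite tensor_mul_pure !right_op_pure mulr1 leg_ractM.
Qed.

(** Together with [leg_ract_right_op], this turns the centre condition into a property of operators:
    for central [z], [right_op z] commutes with the right action of [A]. *)
Lemma right_op_ract z x c : right_op z (leg_ract x c) = right_op (twist_mul z (1 ⊗ c)) x.
Proof.
move: z; apply: tens_ext; [by multilin | by multilin |] => u a.
rewrite right_op_pure leg_act_ract twist_mul_pure.
rewrite (lin_tev _ _ ((leg_ract_bilin _).1 _)) (lin_tev _ _ ((right_op_bilin _).1 _)).
by apply: eq_tev => u1 u2; rewrite right_op_pure mulr1 leg_ractM.
Qed.

End OperatorProducts.

(** * The action as conjugation of operators, and the coaction *)

Section CentreAction.
Variables (k : fieldType) (H : hopfAlgebra k).
Implicit Types (g h : H).

Definition centre_act (A : hmodAlgebra H) (h : H) (z : (H ⊗ A)%type) : (H ⊗ A)%type :=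
  \ten_(u, a <- z) \ten_(h1, h' <- cop h) \ten_(h2, h3 <- cop h')
    (h1 * u * antipode h3) ⊗ hact h2 a.

Definition centre_coact (V : lmodType k) (z : (H ⊗ V)%type) : (H ⊗ (H ⊗ V))%type :=
  \ten_(u, a <- z) \ten_(u1, u2 <- cop u) u1 ⊗ (u2 ⊗ a).

Lemma centre_act_bilin (A : hmodAlgebra H) : bilin (@centre_act A).
Proof. by rewrite /centre_act; multibil. Qed.

Lemma centre_coact_linear (V : lmodType k) : linear (@centre_coact V).
Proof. by rewrite /centre_coact; multilin. Qed.

Lemma centre_act_pure (A : hmodAlgebra H) h u (a : A) : centre_act h (u ⊗ a) =
  \ten_(h1, h' <- cop h) \ten_(h2, h3 <- cop h') (h1 * u * antipode h3) ⊗ hact h2 a.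
Proof. by rewrite /centre_act ten_pure //; multibil. Qed.

Lemma centre_coact_pure (V : lmodType k) u (a : V) :
  centre_coact (u ⊗ a) = \ten_(u1, u2 <- cop u) u1 ⊗ (u2 ⊗ a).
Proof. by rewrite /centre_coact ten_pure //; multibil. Qed.

End CentreAction.
#[export] Hint Extern 1 (bilin _) => exact: centre_act_bilin : multilin.
#[export] Hint Extern 1 (GRing.linear_for _ _) => exact: centre_coact_linear : multilin.

Section OperatorActions.
Variables (k : fieldType) (H : hopfAlgebra k) (B A : hmodAlgebra H) (M : hbimodule B A).
Implicit Types (x : (H ⊗ M)%type) (z : (H ⊗ A)%type) (w : (H ⊗ B)%type) (g h : H).
Local Notation S := (@antipode k H).

(** [H] acts by conjugating operators. As [left_op_act] has the same shape, the relation is stable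
    under [H]. *)
Lemma right_op_act h z x : right_op (centre_act h z) x =
  \ten_(h1, h2 <- cop h) leg_act h1 (right_op z (leg_act (S h2) x)).
Proof.
move: z; apply: tens_ext; [by multilin | by multilin |] => u a.
transitivity (\ten_(h1, h' <- cop h) \ten_(h2, h3 <- cop h')
    leg_ract (leg_act (h1 * u * S h3) x) (hact h2 a)).
  rewrite centre_act_pure (lin_tev _ _ ((right_op_bilin _).1 _)); apply: eq_tev => h1 h'.
  rewrite (lin_tev _ _ ((right_op_bilin _).1 _)); apply: eq_tev => h2 h3.
  by rewrite right_op_pure.
rewrite (@copA3 _ _ _ (fun h1 h2 h3 => leg_ract (leg_act (h1 * u * S h3) x) (hact h2 a)));
  try by move=> ? ?; multilin.
apply: eq_tev => h' h3; rewrite right_op_pure leg_act_ract.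
by apply: eq_tev => h1 h2; rewrite !leg_actM.
Qed.

(** For [w = v ⊗ b] the conjugate sends [g ⊗ m] to the sum of [h1 v S(h4) g ⊗ h2(b S(h3)(m))]. The
    action of [h2] distributes over the product, and its part on [m] cancels against [S(h3)]. *)
Lemma left_op_act h w x : left_op (centre_act h w) x =
  \ten_(h1, h2 <- cop h) leg_act h1 (left_op w (leg_act (S h2) x)).
Proof.
move: w; apply: tens_ext; [by multilin | by multilin |] => v b.
move: x; apply: tens_ext; [by multilin | by multilin |] => g m.
symmetry.
transitivity (\ten_(h1, h' <- cop h) \ten_(h2, h'' <- cop h') \ten_(h3, h4 <- cop h'')
    (h1 * v * S h4 * g) ⊗ hact h2 (lact b (hact (S h3) m))).
  transitivity (\ten_(h', h'' <- cop h) \ten_(h1, h2 <- cop h') \ten_(h3, h4 <- cop h'')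
      (h1 * v * S h4 * g) ⊗ hact h2 (lact b (hact (S h3) m))).
    apply: eq_tev => h' h''.
    rewrite leg_act_pure (lin_tev _ _ ((left_op_bilin _).2 _)).
    rewrite (lin_tev _ _ ((leg_act_bilin _).2 _)) cop_antipode_ten; last by multibil.
    rewrite [RHS]tevC; apply: eq_tev => h3 h4; rewrite left_op_pure leg_act_pure.
    by apply: eq_tev => h1 h2; rewrite !mulrA.
  by rewrite copA3r //; move=> ? ?; multilin.
rewrite centre_act_pure (lin_tev _ _ ((left_op_bilin _).1 _)); apply: eq_tev => h1 h'.
rewrite (lin_tev _ _ ((left_op_bilin _).1 _)).
transitivity (\ten_(h2, h'' <- cop h') \ten_(h3, h4 <- cop h'')
    (h1 * v * S h4 * g) ⊗ hact h2 (lact b (hact (S h3) m))); first by [].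
rewrite (@copA3 _ _ _ (fun h2 h3 h4 => (h1 * v * S h4 * g) ⊗ hact h2 (lact b (hact (S h3) m))));
  try by move=> ? ?; multilin.
apply: eq_tev => h2 h4; rewrite left_op_pure.
have l : linear (fun y => (h1 * v * S h4 * g) ⊗ (y : M)) by multilin.
rewrite -(lin_tev _ _ l); congr (_ ⊗ _).
transitivity (\ten_(a, b' <- cop h2) \ten_(c, d <- cop b') lact (hact a b) (hact (c * S d) m)).
  rewrite [RHS]copA3; try by move=> ? ?; multilin.
  apply: eq_tev => a c; rewrite hact_lact.
  by apply: eq_tev => d e; rewrite hactM.
rewrite (contract_r (@antipoder _ H) (F := fun p q => lact (hact p b) (hact q m))).
  by rewrite hact1.
by multibil.
Qed.

End OperatorActions.

(** * The Yetter-Drinfeld algebra [H ⊗ A] *)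

Section CentreYD.
Variables (k : fieldType) (H : hopfAlgebra k) (A : hmodAlgebra H).
Implicit Types (x y z : (H ⊗ A)%type) (g h : H).
Local Notation S := (@antipode k H).
Local Notation one := (1 ⊗ aone A).
Local Notation rleg_act := (leg_act (M := regbimod A)).
Local Notation rleg_mulr := (leg_mulr (M := regbimod A)).
Local Notation rleft_op := (left_op (M := regbimod A)).

Lemma tensor_mulz1 z : tensor_mul z one = z.
Proof.
move: z; apply: (@tens_ext _ _ _ _ _ _ _ _ id) => //; first by multilin.
by move=> u a; rewrite tensor_mul_pure mulr1 amula1.
Qed.

Lemma tensor_mul1z z : tensor_mul one z = z.
Proof.
move: z; apply: (@tens_ext _ _ _ _ _ _ _ _ id) => //; first by multilin.
by move=> u a; rewrite tensor_mul_pure mul1r amul1a.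
Qed.

Lemma tensor_mulA : associative (@tensor_mul k H A).
Proof. by move=> x y z; rewrite [RHS](@left_op_mul _ _ _ _ (regbimod A)). Qed.

Lemma tensor_mul_algebra : is_algebra (@tensor_mul k H A) one.
Proof.
by split; [exact: tensor_mul_bilin | exact: tensor_mulA | exact: tensor_mul1z |
  exact: tensor_mulz1].
Qed.

(** The unit makes left multiplication faithful; the axioms of [centre_act] can thus be checked on
    operators, where the action is conjugation. *)
Lemma eq_tensor_mul z z' : (forall x, tensor_mul z x = tensor_mul z' x) -> z = z'.
Proof. by move=> zz'; rewrite -[z]tensor_mulz1 zz' tensor_mulz1. Qed.

Lemma centre_act_hmodule : is_hmodule (@centre_act k H A).
Proof.
split=> [|z|g h z]; first exact: centre_act_bilin; apply: eq_tensor_mul => x.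
  rewrite tensor_mulE left_op_act cop1_ten; last by multibil.
  by rewrite antipode1 !leg_act1.
rewrite !tensor_mulE !left_op_act copM_ten; last by multibil.
apply: eq_tev => g1 g2; rewrite left_op_act (lin_tev _ _ ((leg_act_bilin _).2 _)).
by apply: eq_tev => h1 h2; rewrite antipodeM !leg_actM.
Qed.

(** Conjugating the two operators separately gives [h1 x S(h2) h3 y S(h4)], whose middle legs
    cancel. *)
Lemma centre_act_mul h x y : centre_act h (tensor_mul x y) =
  \ten_(h1, h2 <- cop h) tensor_mul (centre_act h1 x) (centre_act h2 y).
Proof.
apply: eq_tensor_mul => z; rewrite tensor_mulE left_op_act.
transitivity (\ten_(h', h'' <- cop h) \ten_(h1, h2 <- cop h') \ten_(h3, h4 <- cop h'')
    rleg_act h1 (rleft_op x (rleg_act (S h2 * h3)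
      (rleft_op y (rleg_act (S h4) z))))); last first.
  rewrite (lin_tev _ _ ((tensor_mul_bilin A).1 _)); apply: eq_tev => h' h''.
  rewrite -tensor_mulA tensor_mulE left_op_act; apply: eq_tev => h1 h2.
  rewrite tensor_mulE left_op_act (lin_tev _ _ ((leg_act_bilin _).2 _)).
  rewrite (lin_tev _ _ ((left_op_bilin _).2 _)) (lin_tev _ _ ((leg_act_bilin _).2 _)).
  by apply: eq_tev => h3 h4; rewrite leg_actM.
rewrite copA3r; try by move=> ? ?; multilin.
apply: eq_tev => h1 h'.
rewrite (contract_l (@antipodel _ H) _ (F := fun p q => rleg_act h1 (rleft_op x
  (rleg_act p (rleft_op y (rleg_act (S q) z)))))); try by multibil.
by rewrite leg_act1 left_op_mul.
Qed.

Lemma centre_act1 h : centre_act h one = counit h *: one.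
Proof.
apply: eq_tensor_mul => z; rewrite tensor_mulE left_op_act.
transitivity (\ten_(h1, h2 <- cop h) rleg_act (h1 * S h2) z).
  by apply: eq_tev => h1 h2; rewrite -tensor_mulE tensor_mul1z leg_actM.
rewrite (contract (@antipoder _ H) (f := fun h => rleg_act h z)); last by multilin.
by rewrite leg_act1 (lin_scale ((tensor_mul_bilin A).1 _)) tensor_mul1z.
Qed.

Lemma centre_coact_comodule : is_comodule (@centre_coact k H A).
Proof.
split; first by multilin.
- apply: tens_ext; [by multilin | by multilin |] => u a.
  rewrite centre_coact_pure !ten_map; try by multibil.
  rewrite copA3r; try by move=> ? ?; multilin.
  apply: eq_tev => u1 u'; rewrite centre_coact_pure ten_map //; multibil.
- apply: (@tens_ext _ _ _ _ _ _ _ _ id) => //; first by multilin.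
  move=> u a; rewrite centre_coact_pure ten_map; last by multibil.
  by rewrite (counitl_lin u (f := fun u => u ⊗ a)) //; multilin.
Qed.

Lemma centre_coact_mul x y : centre_coact (tensor_mul x y) =
  \ten_(u, x0 <- centre_coact x) \ten_(v, y0 <- centre_coact y) (u * v) ⊗ tensor_mul x0 y0.
Proof.
move: x; apply: tens_ext; [by multilin | by multilin |] => u a.
move: y; apply: tens_ext; [by multilin | by multilin |] => v b.
rewrite tensor_mul_pure !centre_coact_pure copM_ten; last by multibil.
rewrite ten_map; last by multibil.
apply: eq_tev => u1 u2; rewrite ten_map; last by multibil.
by apply: eq_tev => v1 v2; rewrite tensor_mul_pure.
Qed.

(** This splits the action into the diagonal action and a right multiplication, whose effects on the
    coaction are computed separately. *)
Lemma centre_actE h z :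
  centre_act h z = \ten_(h1, h2 <- cop h) leg_mulr (rleg_act h1 z) (S h2).
Proof.
move: z; apply: tens_ext; [by multilin | by multilin |] => u a.
rewrite centre_act_pure (@copA3 _ _ _ (fun h1 h2 h3 => (h1 * u * S h3) ⊗ hact h2 a));
  try by move=> ? ?; multilin.
apply: eq_tev => h' h3; rewrite leg_act_pure (lin_tev _ _ ((leg_mulr_bilin _).1 _)).
by apply: eq_tev => h1 h2; rewrite leg_mulr_pure.
Qed.

Lemma centre_coact_leg_act h z : centre_coact (rleg_act h z) =
  \ten_(h1, h2 <- cop h) \ten_(u, z0 <- centre_coact z)
    (h1 * u) ⊗ rleg_act h2 z0.
Proof.
move: z; apply: tens_ext; [by multilin | by multilin |] => u a.
rewrite leg_act_pure (lin_tev _ _ (@centre_coact_linear k H A)) centre_coact_pure.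
transitivity (\ten_(h', h3 <- cop h) \ten_(h1, h2 <- cop h') \ten_(u1, u2 <- cop u)
    (h1 * u1) ⊗ ((h2 * u2) ⊗ hact h3 a)).
  by apply: eq_tev => h' h3; rewrite centre_coact_pure copM_ten //; multibil.
rewrite copA3r; try by move=> ? ?; multilin.
apply: eq_tev => h1 h'; rewrite ten_map; last by multibil.
rewrite tevC; apply: eq_tev => u1 u2; rewrite leg_act_pure.
by rewrite (lin_tev _ _ ((tpure_bilin _ _).2 _)).
Qed.

Lemma centre_coact_leg_mulr z g : centre_coact (rleg_mulr z g) =
  \ten_(g1, g2 <- cop g) \ten_(u, z0 <- centre_coact z)
    (u * g1) ⊗ rleg_mulr z0 g2.
Proof.
move: z; apply: tens_ext; [by multilin | by multilin |] => u a.
rewrite leg_mulr_pure !centre_coact_pure copM_ten; last by multibil.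
rewrite tevC; apply: eq_tev => g1 g2; rewrite ten_map; last by multibil.
by apply: eq_tev => u1 u2; rewrite leg_mulr_pure.
Qed.

(** This is the Yetter-Drinfeld condition solved for the coaction of [h z]. Multiplying by a further
    leg [h4], which cancels [S(h3)], gives the form used in the definition. *)
Lemma centre_coact_act h z : centre_coact (centre_act h z) =
  \ten_(h1, h' <- cop h) \ten_(h2, h3 <- cop h') \ten_(u, z0 <- centre_coact z)
    (h1 * u * S h3) ⊗ centre_act h2 z0.
Proof.
pose X h1 h2 h4 h5 := \ten_(u, z0 <- centre_coact z)
  (h1 * u * S h5) ⊗ leg_mulr (rleg_act h2 z0) (S h4).
transitivity (\ten_(h', h'' <- cop h) \ten_(h1, h2 <- cop h') \ten_(h4, h5 <- cop h'')
    X h1 h2 h4 h5).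
  rewrite centre_actE (lin_tev _ _ (@centre_coact_linear k H A)); apply: eq_tev => h' h''.
  rewrite centre_coact_leg_mulr cop_antipode_ten; last by multibil.
  rewrite [RHS]tevC; apply: eq_tev => h4 h5.
  rewrite centre_coact_leg_act ten_ten; last by multibil.
  by apply: eq_tev => h1 h2; rewrite ten_map //; multibil.
rewrite copA3r; try by move=> ? ?; rewrite /X; multilin.
apply: eq_tev => h1 h'.
rewrite (@copA3 _ _ _ (fun h2 h4 h5 => X h1 h2 h4 h5)); try by move=> ? ?; rewrite /X; multilin.
apply: eq_tev => h2 h5; rewrite /X tevC; apply: eq_tev => u z0.
by rewrite centre_actE (lin_tev _ _ ((tpure_bilin _ _).2 _)).
Qed.

Lemma centre_yd_module : is_yd_module (@centre_act k H A) (@centre_coact k H A).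
Proof.
split; [exact: centre_act_hmodule | exact: centre_coact_comodule |] => h z.
pose X h1 h2 (g : H) := \ten_(u, z0 <- centre_coact z) (h1 * u * g) ⊗ centre_act h2 z0.
transitivity (\ten_(h', h4 <- cop h) \ten_(h1, h'' <- cop h') \ten_(h2, h3 <- cop h'')
    X h1 h2 (S h3 * h4)); last first.
  apply: eq_tev => h' h4; rewrite centre_coact_act ten_ten; last by multibil.
  apply: eq_tev => h1 h''; rewrite ten_ten; last by multibil.
  apply: eq_tev => h2 h3; rewrite ten_map; last by multibil.
  by apply: eq_tev => u z0; rewrite !mulrA.
rewrite copA3r; try by move=> ? ?; rewrite /X; multilin.
apply: eq_tev => h1 h'.
rewrite copA3r; try by move=> ? ?; rewrite /X; multilin.
rewrite (contract_r (@antipodel _ H) (F := fun p q => X h1 p q));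
  last by rewrite /X; multibil.
by apply: eq_tev => u z0; rewrite mulr1.
Qed.

Definition centre_data : ydData H (H ⊗ A)%type :=
  YDData (@centre_act k H A) (@centre_coact k H A) (@tensor_mul k H A) one.

Lemma centre_yd_algebra : is_yd_algebra centre_data.
Proof.
split; [split | | | |] => /=.
- exact: centre_yd_module.
- exact: tensor_mul_algebra.
- exact: centre_act_mul.
- exact: centre_act1.
- exact: centre_coact_mul.
- by rewrite centre_coact_pure cop1_ten //; multibil.
Qed.

(** Both sides are [u1 v S(u3) u4 ⊗ u2(b) a] for [z = u ⊗ a] and [y = v ⊗ b]. *)
Lemma braided_opposite_mul z y :
  \ten_(u, z0 <- centre_coact z) tensor_mul (centre_act u y) z0 = twist_mul z y.
Proof.
move: z; apply: tens_ext; [by multilin | by multilin |] => u a.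
move: y; apply: tens_ext; [by multilin | by multilin |] => v b.
rewrite centre_coact_pure ten_map; last by multibil.
rewrite twist_mul_pure.
transitivity (\ten_(u', u4 <- cop u) \ten_(u1, u'' <- cop u') \ten_(u2, u3 <- cop u'')
    (u1 * v * (S u3 * u4)) ⊗ amul (hact u2 b) a).
  apply: eq_tev => u' u4; rewrite centre_act_pure (lin_tev _ _ ((tensor_mul_bilin A).1 _)).
  apply: eq_tev => u1 u''; rewrite (lin_tev _ _ ((tensor_mul_bilin A).1 _)).
  by apply: eq_tev => u2 u3; rewrite tensor_mul_pure mulrA.
rewrite copA3r; try by move=> ? ?; multilin.
apply: eq_tev => u1 u'.
rewrite copA3r; try by move=> ? ?; multilin.
rewrite (contract_r (@antipodel _ H) (F := fun p q => (u1 * v * q) ⊗ amul (hact p b) a));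
  last by multibil.
by rewrite mulr1.
Qed.

(** Convertible with [related (regbimod A) z z], defined below. *)
Definition in_centre z := forall x, tensor_mul z x = twist_mul z x.

End CentreYD.

(** * The relation between [H ⊗ A] and [H ⊗ B] *)

Section Related.
Variables (k : fieldType) (H : hopfAlgebra k) (B A : hmodAlgebra H) (M : hbimodule B A).
Implicit Types (m : M) (z : (H ⊗ A)%type) (w : (H ⊗ B)%type) (g h : H).
Local Notation S' := (@antipodeV k H).

Definition related z w := forall x : (H ⊗ M)%type, left_op w x = right_op z x.

(** The operation of a linear form on the comodule [H ⊗ V]. Over a field, a subspace stable under
    all of these is a subcomodule. *)
Definition coslice (V : lmodType k) (phi : H -> k) (z : (H ⊗ V)%type) : (H ⊗ V)%type :=
  slice phi (centre_coact z).

Definition centre_ev z m : M := \ten_(u, a <- z) ract (hact u m) a.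
(** The action on [M] of the element [b # S^-1(v)] of [B # H], which [centr_embed] sends to
    [v ⊗ b]. *)
Definition centraliser_ev w m : M := \ten_(v, b <- w) lact b (hact (S' v) m).

Lemma centre_ev_bilin : bilin centre_ev.
Proof. by rewrite /centre_ev; multibil. Qed.
Lemma centraliser_ev_bilin : bilin centraliser_ev.
Proof. by rewrite /centraliser_ev; multibil. Qed.

Lemma centre_ev_pure u a m : centre_ev (u ⊗ a) m = ract (hact u m) a.
Proof. by rewrite /centre_ev ten_pure //; multibil. Qed.
Lemma centraliser_ev_pure v b m : centraliser_ev (v ⊗ b) m = lact b (hact (S' v) m).
Proof. by rewrite /centraliser_ev ten_pure //; multibil. Qed.

Lemma left_op_unit w m : left_op w (1 ⊗ m) = \ten_(v, b <- w) v ⊗ lact b m.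
Proof.
move: w; apply: tens_ext; [by multilin | by multilin |] => v b.
by rewrite left_op_pure ten_pure ?mulr1 //; multibil.
Qed.

Lemma right_op_unit_pure u a m :
  right_op (u ⊗ a) (1 ⊗ m) = \ten_(u1, u2 <- cop u) u1 ⊗ ract (hact u2 m) a.
Proof.
rewrite right_op_pure leg_act_pure (lin_tev _ _ ((leg_ract_bilin _).1 _)).
by apply: eq_tev => u1 u2; rewrite leg_ract_pure mulr1.
Qed.

Lemma right_op_unit z m :
  right_op z (1 ⊗ m) = \ten_(h, y <- centre_coact z) h ⊗ centre_ev y m.
Proof.
have be := centre_ev_bilin.
move: z; apply: tens_ext; [by multilin | by multilin |] => u a.
rewrite right_op_unit_pure centre_coact_pure ten_map; last by multibil.
by apply: eq_tev => u1 u2; rewrite centre_ev_pure.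
Qed.

(** Both operators commute with right multiplication on the factor [H], so their values at [1 ⊗ m]
    determine them. *)
Lemma related_unit z w :
  (forall m, left_op w (1 ⊗ m) = right_op z (1 ⊗ m)) -> related z w.
Proof.
move=> zw; apply: tens_ext; [by multilin | by multilin |] => g m.
by rewrite -[g]mul1r -leg_mulr_pure left_op_mulr right_op_mulr zw.
Qed.

Lemma related_linear a z w z' w' :
  related z w -> related z' w' -> related (a *: z + z') (a *: w + w').
Proof.
by move=> zw zw' x; rewrite ((left_op_bilin _).1 x) ((right_op_bilin _).1 x) zw zw'.
Qed.

Lemma related1 : related (1 ⊗ aone A) (1 ⊗ aone B).
Proof.
apply: related_unit => m.
by rewrite left_op_pure right_op_pure leg_act1 leg_ract_pure mul1r lact1 ract1.
Qed.

Lemma related_act h z w : related z w -> related (centre_act h z) (centre_act h w).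
Proof.
by move=> zw x; rewrite left_op_act right_op_act; apply: eq_tev => h1 h2; rewrite zw.
Qed.

Lemma right_op_leg_act z g a (x : (H ⊗ M)%type) :
  right_op (tensor_mul z (1 ⊗ a)) (leg_act g x) = right_op (tensor_mul z (g ⊗ a)) x.
Proof.
move: z; apply: tens_ext; [by multilin | by multilin |] => u c.
by rewrite !tensor_mul_pure !right_op_pure mulr1 leg_actM.
Qed.

(** Composing [right_op z] with the operator of [g ⊗ a] produces [twist_mul z (1 ⊗ a)] where
    [tensor_mul z (1 ⊗ a)] is wanted; centrality of [z] exchanges the two. *)
Lemma related_mul z w z' w' : in_centre z -> related z w -> related z' w' ->
  related (tensor_mul z z') (tensor_mul w w').
Proof.
move=> cz zw zw' x; rewrite left_op_mul zw' zw.
move: z' {zw'}; apply: tens_ext; [by multilin | by multilin |] => g a.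
by rewrite right_op_pure right_op_ract -cz right_op_leg_act.
Qed.

Lemma coslice_linear (V : lmodType k) phi : scalar phi -> linear (@coslice V phi).
Proof.
move=> lphi; have ls := slice_linear (W := (H ⊗ V)%type) lphi.
by rewrite /coslice; multilin.
Qed.

Lemma coslice_pure (V : lmodType k) phi u (a : V) : scalar phi ->
  coslice phi (u ⊗ a) = \ten_(u1, u2 <- cop u) phi u1 *: (u2 ⊗ a).
Proof.
move=> lphi; rewrite /coslice centre_coact_pure (lin_tev _ _ (slice_linear lphi)).
by apply: eq_tev => u1 u2; rewrite slice_pure.
Qed.

(** At [1 ⊗ m], for either operator, the coslice of the result is the result of the coslice. *)
Lemma related_coslice phi z w : scalar phi -> related z w ->
  related (coslice phi z) (coslice phi w).
Proof.
move=> lphi zw; apply: related_unit => m.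
have lA := @coslice_linear A phi lphi; have lB := @coslice_linear B phi lphi.
have lM := @coslice_linear M phi lphi.
transitivity (coslice phi (left_op w (1 ⊗ m))); last rewrite zw.
  move: w {zw}; apply: tens_ext; [by multilin | by multilin |] => v b.
  rewrite left_op_pure mulr1 !coslice_pure // (lin_tev _ _ ((left_op_bilin _).1 _)).
  apply: eq_tev => v1 v2.
  by rewrite (lin_scale ((left_op_bilin _).1 _)) left_op_pure mulr1.
move: z {zw}; apply: tens_ext; [by multilin | by multilin |] => u a.
rewrite right_op_unit_pure coslice_pure // (lin_tev _ _ lM).
rewrite (lin_tev _ _ ((right_op_bilin _).1 _)).
transitivity (\ten_(u', u3 <- cop u) \ten_(u1, u2 <- cop u')
    phi u1 *: (u2 ⊗ ract (hact u3 m) a)).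
  by apply: eq_tev => u' u3; rewrite coslice_pure.
rewrite copA3r; try by move=> ? ?; multilin.
apply: eq_tev => u1 u'; rewrite (lin_scale ((right_op_bilin _).1 _)) right_op_unit_pure.
by rewrite -(lin_tev _ _ (@lin_scaler _ _ _)).
Qed.

(** Replacing [m] by [S^-1(h2)(m)], with [h2] the second leg of the first tensor factor, cancels the
    leg of [u] that acts on [m] in [right_op]; replacing [m] by [h2(m)] leads back.
    [leg_substitution] is what lets [m] depend on a leg. *)
Lemma relatedP z w : related z w <->
  forall m, \ten_(u, a <- z) u ⊗ ract m a =
            \ten_(h, y <- centre_coact w) h ⊗ centraliser_ev y m.
Proof.
have be := centre_ev_bilin; have be' := centraliser_ev_bilin.
split=> [zw m | zw].
  have bl : bilin (fun (b : B) m => lact b m) by multibil.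
  have lG : linear (fun h => hact (S' h) m) by multilin.

  have E := @leg_substitution _ _ _ _ _ _ _ _ w (centre_coact z) _ bl be lG
    (fun m1 => etrans (esym (left_op_unit w m1)) (etrans (zw _) (right_op_unit z m1))).
  symmetry; transitivity (\ten_(h, u <- w) \ten_(h1, h2 <- cop h)
      h1 ⊗ lact u (hact (S' h2) m)).
    move: w {zw E}; apply: tens_ext; [by multilin | by multilin |] => v b.
    rewrite centre_coact_pure ten_map; last by multibil.
    rewrite ten_pure; last by multibil.
    by apply: eq_tev => v1 v2; rewrite centraliser_ev_pure.
  rewrite E; move: z {zw E}; apply: tens_ext; [by multilin | by multilin |] => u a.
  rewrite centre_coact_pure ten_map; last by multibil.
  rewrite ten_pure; last by multibil.
  transitivity (\ten_(u', u3 <- cop u) \ten_(u1, u2 <- cop u')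
      u1 ⊗ ract (hact (u3 * S' u2) m) a).
    by apply: eq_tev => u' u3; apply: eq_tev => u1 u2; rewrite centre_ev_pure hactM.
  rewrite copA3r; try by move=> ? ?; multilin.
  rewrite (contract_r (@antipodeVr _ H) (F := fun p q => p ⊗ ract (hact q m) a));
    last by multibil.
  by rewrite hact1.
apply: related_unit => m.
have bl : bilin (fun (a : A) m => ract m a) by multibil.
have lG : linear (fun h => hact h m) by multilin.
have := @leg_substitution _ _ _ _ _ _ _ _ z (centre_coact w) _ bl be' lG zw.
move=> E; symmetry; transitivity (\ten_(h, u <- z) \ten_(h1, h2 <- cop h)
    h1 ⊗ ract (hact h2 m) u).
  move: z {zw E}; apply: tens_ext; [by multilin | by multilin |] => u a.
  by rewrite right_op_unit_pure ten_pure //; multibil.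
rewrite E; move: w {zw E}; apply: tens_ext; [by multilin | by multilin |] => v b.
rewrite centre_coact_pure ten_map; last by multibil.
rewrite left_op_pure mulr1.
transitivity (\ten_(v', v3 <- cop v) \ten_(v1, v2 <- cop v')
    v1 ⊗ lact b (hact (S' v3 * v2) m)).
  by apply: eq_tev => v' v3; apply: eq_tev => v1 v2; rewrite centraliser_ev_pure hactM.
rewrite copA3r; try by move=> ? ?; multilin.
rewrite (contract_r (@antipodeVl _ H) (F := fun p q => p ⊗ lact b (hact q m)));
  last by multibil.
by rewrite hact1.
Qed.

End Related.

(** * The centraliser as a Yetter-Drinfeld algebra *)

Section Pullback.
Variables (k : fieldType) (H : hopfAlgebra k) (C D : lmodType k).
Variables (s : ydData H C) (t : ydData H D) (f : C -> D).

Definition yd_morphism : Prop :=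
  [/\ linear f, forall h x, f (yact s h x) = yact t h (f x),
      forall x, ycoact t (f x) = \ten_(u, x0 <- ycoact s x) u ⊗ f x0,
      forall x y, f (ymul s x y) = ymul t (f x) (f y)
    & f (yone s) = yone t].

Hypotheses (fP : yd_morphism) (injf : injective f).

Let lf : linear f. Proof. by case: fP. Qed.
Let f_act h x : f (yact s h x) = yact t h (f x). Proof. by case: fP. Qed.
Let f_mul x y : f (ymul s x y) = ymul t (f x) (f y). Proof. by case: fP. Qed.
Let f_one : f (yone s) = yone t. Proof. by case: fP. Qed.

Let Tf (x : (H ⊗ C)%type) := \ten_(u, c <- x) u ⊗ f c.

Let lTf : linear Tf. Proof. by rewrite /Tf; multilin. Qed.

Let injTf : injective Tf. Proof. exact: map_tens_inj. Qed.

Let f_coact x : Tf (ycoact s x) = ycoact t (f x). Proof. by case: fP. Qed.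

Let coact_ten (U : lmodType k) (F : H -> D -> U) x : bilin F ->
  \ten_(u, x0 <- ycoact s x) F u (f x0) = \ten_(u, d <- ycoact t (f x)) F u d.
Proof. by move=> bF; rewrite -f_coact ten_map. Qed.

(** Each axiom is tested after [f], or after [Tf] when its values lie in [H ⊗ C]: both are injective
    and turn it into the axiom for [t]. *)
Lemma yd_algebra_pullback : is_yd_algebra t -> is_yd_algebra s.
Proof.
move=> [[[[bact act1 actM] [lcoact coactA coact1] act_coact] [bmul mulA mul1 mulr1]]].
move=> act_mul act_one coact_mul coact_one.
split; first split.
- split; first split.
  + split=> [x|h] a u v; apply: injf; first by rewrite lf !f_act (bact.1 (f x)).
    by rewrite f_act !lf !f_act (bact.2 h).
  + by move=> x; apply: injf; rewrite f_act act1.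
  + by move=> g h x; apply: injf; rewrite !f_act actM.
  + split.
    * by move=> a x y; apply: injTf; rewrite lTf !f_coact lf lcoact.
    (* Coassociativity takes place in [H ⊗ (H ⊗ C)], on which [Tf] acts in the second factor. *)
    * move=> x; apply: (map_tens_inj lTf injTf) => /=.
      have bT : bilin (fun u y => u ⊗ Tf y) by multibil.
      transitivity (\ten_(h, d <- ycoact t (f x)) \ten_(h1, h2 <- cop h) h1 ⊗ (h2 ⊗ d)).
        rewrite -coact_ten; last by multibil.
        rewrite ten_ten //; apply: eq_tev => h x0; rewrite ten_map //.
        by apply: eq_tev => h1 h2; rewrite /Tf ten_pure //; multibil.
      rewrite coactA ten_ten //.
      transitivity (\ten_(h, d <- ycoact t (f x)) h ⊗ ycoact t d).
        apply: eq_tev => h d; rewrite -[in RHS](ten_id (ycoact t d)).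
        by rewrite [RHS](lin_tev _ _ ((tpure_bilin _ _).2 _)).
      rewrite -coact_ten; last by multibil.
      apply: eq_tev => h x0; rewrite ten_map // -f_coact [in LHS]/Tf.
      rewrite [LHS](lin_tev _ _ ((tpure_bilin _ _).2 _)); apply: eq_tev => h2 x1.
      by rewrite /Tf ten_pure //; multibil.
    * move=> x; apply: injf; rewrite (lin_tev _ _ lf) -[RHS]coact1.
      rewrite -coact_ten; last by multibil.
      by apply: eq_tev => h x0; rewrite (lin_scale lf).
  + move=> h x; apply: injTf; rewrite !(lin_tev _ _ lTf).
    transitivity (\ten_(h1, h2 <- cop h) \ten_(u, m0 <- ycoact t (f x)) (h1 * u) ⊗ yact t h2 m0).
      apply: eq_tev => h1 h2; rewrite -coact_ten; last by multibil.
      rewrite (lin_tev _ _ lTf); apply: eq_tev => u x0.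
      by rewrite /Tf ten_pure ?f_act //; multibil.
    rewrite act_coact; apply: eq_tev => h1 h2; rewrite -f_act -coact_ten; last by multibil.
    rewrite (lin_tev _ _ lTf); apply: eq_tev => u x0.
    by rewrite /Tf ten_pure //; multibil.
- split.
  + split=> [y|x] a u v; apply: injf; first by rewrite lf !f_mul lf (bmul.1 (f y)).
    by rewrite lf !f_mul lf (bmul.2 (f x)).
  + by move=> x y z; apply: injf; rewrite !f_mul mulA.
  + by move=> x; apply: injf; rewrite f_mul f_one mul1.
  + by move=> x; apply: injf; rewrite f_mul f_one mulr1.
- move=> h x y; apply: injf; rewrite f_act f_mul act_mul (lin_tev _ _ lf).
  by apply: eq_tev => h1 h2; rewrite f_mul !f_act.
- by move=> h; apply: injf; rewrite f_act (lin_scale lf) f_one act_one.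
- move=> x y; apply: injTf; rewrite f_coact f_mul coact_mul (lin_tev _ _ lTf).
  rewrite -coact_ten; last by multibil.
  apply: eq_tev => u x0; rewrite (lin_tev _ _ lTf) -coact_ten; last by multibil.
  by apply: eq_tev => v y0; rewrite /Tf ten_pure ?f_mul //; multibil.
- apply: injTf; rewrite f_coact f_one coact_one /Tf ten_pure ?f_one //; multibil.
Qed.

(** The identity is asked only for left factors in the image of [f], since [H ⊗ A] as a whole need
    not be commutative. *)
Lemma yd_commutative_pullback : bilin (ymul t) -> bilin (yact t) ->
  (forall x y, ymul t (f x) y = \ten_(u, x0 <- ycoact t (f x)) ymul t (yact t u y) x0) ->
  yd_commutative s.
Proof.
move=> bmul bact tcomm x y; apply: injf; rewrite f_mul tcomm (lin_tev _ _ lf).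
rewrite -coact_ten; last by multibil.
by apply: eq_tev => u x0; rewrite f_mul f_act.
Qed.

End Pullback.

(** * The centraliser inside [H ⊗ A] *)

Section CentraliserEmbedding.
Variables (k : fieldType) (H : hopfAlgebra k) (A : hmodAlgebra H).
Local Notation S := (@antipode k H).
Local Notation S' := (@antipodeV k H).
Implicit Types x y : (A ⊗ H)%type.

Lemma centr_embed_linear : linear (@centr_embed k H A).
Proof. by rewrite /centr_embed; multilin. Qed.

Lemma centr_embed_pure a g : centr_embed (a ⊗ g) = S g ⊗ (a : A).
Proof. by rewrite /centr_embed ten_pure //; multibil. Qed.

Definition centr_unembed (z : (H ⊗ A)%type) : (A ⊗ H)%type := \ten_(u, a <- z) a ⊗ S' u.

Lemma centr_unembedK : cancel centr_unembed (@centr_embed k H A).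
Proof.
have l := centr_embed_linear.
apply: (@tens_ext _ _ _ _ _ _ _ _ id) => //; first by rewrite /centr_unembed; multilin.
move=> u a; rewrite /centr_unembed ten_pure; last by multibil.
by rewrite centr_embed_pure antipodeVK.
Qed.

Lemma centr_embedK : cancel (@centr_embed k H A) centr_unembed.
Proof.
have l := centr_embed_linear.
apply: (@tens_ext _ _ _ _ _ _ _ _ id) => //; first by rewrite /centr_unembed; multilin.
move=> a g; rewrite centr_embed_pure /centr_unembed ten_pure ?antipodeK //; multibil.
Qed.

Lemma centr_embed_act h x : centr_embed (centr_act h x) = centre_act h (centr_embed x).
Proof.
have l := centr_embed_linear.
move: x; apply: tens_ext; [by rewrite /centr_act; multilin | by multilin |] => a g.
rewrite centr_embed_pure centre_act_pure /centr_act ten_pure; last by multibil.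
rewrite (lin_tev _ _ l); apply: eq_tev => h1 h'.
rewrite (lin_tev _ _ l); apply: eq_tev => h2 h3.
by rewrite centr_embed_pure !antipodeM antipodeVK mulrA.
Qed.

Lemma centr_embed_coact x :
  \ten_(u, y <- centr_coact x) u ⊗ centr_embed y = centre_coact (centr_embed x).
Proof.
have l := centr_embed_linear.
move: x; apply: tens_ext; [by rewrite /centr_coact; multilin | by multilin |] => a g.
rewrite centr_embed_pure centre_coact_pure /centr_coact ten_pure; last by multibil.
rewrite cop_antipode_ten; last by multibil.
rewrite ten_map; last by multibil.
by apply: eq_tev => g1 g2; rewrite centr_embed_pure.
Qed.

(** [centr_embed] carries the two sides of the centraliser equation to the two sides of [relatedP]
    for the regular bimodule. *)
Lemma in_centraliserP x : in_centraliser x <-> in_centre (centr_embed x).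
Proof.
have l := centr_embed_linear.
have be := @centraliser_ev_bilin _ _ _ _ (regbimod A).
have El (b : A) : centr_embed (smash_mul (b ⊗ 1) x) = \ten_(u, a <- centr_embed x) u ⊗ amul b a.
  have ls : linear (smash_mul (b ⊗ 1)) by apply: smash_linr.
  move: x; apply: tens_ext; [by multilin | by multilin |] => a g.
  rewrite centr_embed_pure ten_pure; last by multibil.
  rewrite /smash_mul !ten_pure; try by multibil.
  by rewrite cop1_ten ?mul1r ?hact1 ?centr_embed_pure //; multibil.
have Er (b : A) : centr_embed (smash_mul x (b ⊗ 1)) =
    \ten_(h, y <- centre_coact (centr_embed x)) h ⊗ centraliser_ev (M := regbimod A) y b.
  have ls := smash_linl (b ⊗ 1).
  move: x {El}; apply: tens_ext; [by apply: lin_comp | by multilin |] => a g.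
  rewrite centr_embed_pure centre_coact_pure ten_map; last by multibil.
  rewrite cop_antipode_ten; last by multibil.
  rewrite /smash_mul !ten_pure; try by multibil.
  rewrite (lin_tev _ _ l); apply: eq_tev => g1 g2.
  by rewrite centr_embed_pure mulr1 (centraliser_ev_pure (M := regbimod A)) antipodeK.
split=> [cx | cx b].
  by apply: (@relatedP _ _ _ _ (regbimod A) _ _).2 => b; rewrite -Er cx El.
apply: (can_inj centr_embedK); rewrite El Er.
by symmetry; apply: (@relatedP _ _ _ _ (regbimod A) _ _).1.
Qed.

Definition centre_of (x : centraliser A) : (H ⊗ A)%type := centr_embed (cval x).

Lemma cval_linear : linear (@cval k H A).
Proof. by []. Qed.

Lemma centre_of_linear : linear centre_of.
Proof. exact: lin_comp centr_embed_linear cval_linear. Qed.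

Lemma centre_of_inj : injective centre_of.
Proof. by move=> x y /(can_inj centr_embedK) /val_inj. Qed.

Lemma centre_of_in (x : centraliser A) : in_centre (centre_of x).
Proof. exact/in_centraliserP/cvalP. Qed.

Lemma centre_of_onto (z : (H ⊗ A)%type) :
  in_centre z -> exists x : centraliser A, centre_of x = z.
Proof.
move=> cz; have px : centr_unembed z \in centr_pred (A := A).
  by apply/asboolP/in_centraliserP; rewrite centr_unembedK.
by exists (Centraliser px); rewrite /centre_of /= centr_unembedK.
Qed.

Lemma is_centraliser_ydP (s : ydData H (centraliser A)) :
  is_centraliser_yd s <-> yd_morphism s (centre_data A) centre_of.
Proof.
have l := centr_embed_linear; have lc := cval_linear.
have injT := map_tens_inj (V := H) l (can_inj centr_embedK).
have coactE (x : centraliser A) :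
    (\ten_(u, y <- ycoact s x) u ⊗ cval y = centr_coact (cval x)) <->
    centre_coact (centre_of x) = \ten_(u, y <- ycoact s x) u ⊗ centre_of y.
  rewrite -centr_embed_coact.
  have <- : \ten_(u, y <- \ten_(u, y <- ycoact s x) u ⊗ cval y) u ⊗ centr_embed y =
      \ten_(u, y <- ycoact s x) u ⊗ centre_of y by rewrite ten_map //; multibil.
  by split=> [-> // | /esym /injT].
split=> [[sact scoact smul sone] | [_ sact scoact smul sone]]; split=> //.
- exact: centre_of_linear.
- by move=> h x; rewrite /centre_of sact centr_embed_act.
- by move=> x; apply: (coactE x).1; apply: scoact.
- by move=> h x; apply: (can_inj centr_embedK); rewrite centr_embed_act; apply: sact.
- by move=> x; apply: (coactE x).2; apply: scoact.
Qed.

End CentraliserEmbedding.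

Section CentraliserYD.
Variables (k : fieldType) (H : hopfAlgebra k) (A : hmodAlgebra H).

Lemma in_centre1 : in_centre (1 ⊗ aone A).
Proof. exact: (@related1 _ _ _ _ (regbimod A)). Qed.

Lemma in_centre_act h (z : (H ⊗ A)%type) : in_centre z -> in_centre (centre_act h z).
Proof. exact: (@related_act _ _ _ _ (regbimod A)). Qed.

Lemma in_centre_mul (z z' : (H ⊗ A)%type) :
  in_centre z -> in_centre z' -> in_centre (tensor_mul z z').
Proof. by move=> cz cz'; apply: (@related_mul _ _ _ _ (regbimod A) z z z' z' cz cz cz'). Qed.

Lemma in_centre_coslice phi (z : (H ⊗ A)%type) :
  scalar phi -> in_centre z -> in_centre (coslice phi z).
Proof. exact: (@related_coslice _ _ _ _ (regbimod A)). Qed.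

(** The slices of the coaction of a central element are its coslices, hence central, and can be
    lifted one at a time. *)
Lemma centre_coact_onto (x : centraliser A) :
  exists t : (H ⊗ centraliser A)%type,
    centre_coact (centre_of x) = \ten_(u, y <- t) u ⊗ centre_of y.
Proof.
have [l lE] := slice_basis (centre_coact (centre_of x)).
have sliceP (p : H * {phi : H -> k | scalar phi}) : exists y : centraliser A,
    centre_of y = slice (sval p.2) (centre_coact (centre_of x)).
  by apply/centre_of_onto/in_centre_coslice; [exact: (svalP p.2) | exact: centre_of_in].
have [y yP] := choice sliceP.
have lc := @centre_of_linear k H A.
have lT : linear (fun t : (H ⊗ centraliser A)%type => \ten_(u, y <- t) u ⊗ centre_of y).
  by multilin.
exists (\sum_(p <- l) p.1 ⊗ y p).
rewrite lE (lin_sum _ _ lT); apply: eq_bigr => p _.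
by rewrite ten_pure ?yP //; multibil.
Qed.

Lemma centraliser_yd_exists :
  exists s : ydData H (centraliser A), yd_morphism s (centre_data A) (@centre_of k H A).
Proof.
have actP (p : H * centraliser A) :
    exists y : centraliser A, centre_of y = centre_act p.1 (centre_of p.2).
  exact/centre_of_onto/in_centre_act/centre_of_in.
have mulP (p : centraliser A * centraliser A) :
    exists y : centraliser A, centre_of y = tensor_mul (centre_of p.1) (centre_of p.2).
  by apply/centre_of_onto/in_centre_mul; apply: centre_of_in.
have [[act actE] [mul mulE]] := (choice actP, choice mulP).
have [coact coactE] := choice centre_coact_onto.
have [one oneE] := centre_of_onto in_centre1.
exists (YDData (fun h x => act (h, x)) coact (fun x y => mul (x, y)) one).
split=> [|h x|x|x y|] /=; [exact: centre_of_linear | exact: actE | exact: coactE | exact: mulE |].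
exact: oneE.
Qed.

Lemma centraliser_yd_algebra (s : ydData H (centraliser A)) :
  yd_morphism s (centre_data A) (@centre_of k H A) -> is_yd_algebra s /\ yd_commutative s.
Proof.
move=> sP; split.
  exact: yd_algebra_pullback sP (@centre_of_inj k H A) (centre_yd_algebra A).
apply: (yd_commutative_pullback sP (@centre_of_inj k H A)) => [||x y].
- exact: tensor_mul_bilin.
- exact: centre_act_bilin.
(* Centrality of [x] turns the product into [twist_mul], the braided opposite product. *)
- by rewrite [LHS]centre_of_in [RHS]braided_opposite_mul.
Qed.

End CentraliserYD.

(** * Equivalences given by a bimodule *)

Section Equivalences.
Variables (C D : category).

Lemma iso_cancel (x y z : C) (e : mor y z) (f g : mor x y) :
  is_iso e -> cmp e f = cmp e g -> f = g.
Proof.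
by move=> [e' [e'e _]] /(congr1 (cmp e')); rewrite !cmpA e'e !cmp1m.
Qed.

Lemma iso_cancel_r (x y z : C) (e : mor x y) (f g : mor y z) :
  is_iso e -> cmp f e = cmp g e -> f = g.
Proof.
by move=> [e' [_ ee']] /(congr1 (fun h => cmp h e')); rewrite -!cmpA ee' !cmpm1.
Qed.

Lemma retract_faithful (F : functor C D) (G : functor D C) :
  nat_isomorphic (fcomp G F) (fid C) ->
  forall (x y : C) (f g : mor x y), fmor F f = fmor F g -> f = g.
Proof.
move=> [eta [nat iso]] x y f g fg; apply: (iso_cancel_r (iso x)).
by have := nat _ _ f; have := nat _ _ g; rewrite /= fg => <- ->.
Qed.
End Equivalences.

Section EquivalenceProperties.
Variables (C D : category) (F : functor C D).
Hypothesis eF : is_equivalence F.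

Lemma equivalence_faithful (x y : C) (f g : mor x y) : fmor F f = fmor F g -> f = g.
Proof. by have [G [GF _]] := eF; apply: (retract_faithful GF). Qed.

Lemma equivalence_full (x y : C) (p : mor (F x) (F y)) : exists f, fmor F f = p.
Proof.
have [G [[eta [nat iso]] FG]] := eF; have [e' [e'e _]] := iso x.
(* [G] is faithful as well, so [fmor F f] and [p] may be compared after applying [G]. *)
exists (cmp (eta y) (cmp (fmor G p) e')); apply: (retract_faithful FG).
apply: (iso_cancel (iso y)); apply: etrans (nat _ _ _) _.
by rewrite /= -!cmpA e'e cmpm1.
Qed.

Lemma equivalence_onto (d : D) : exists c (i : mor (F c) d), is_iso i.
Proof. by have [G [_ [eps [_ iso]]]] := eF; exists (G d), (eps d); exact: (iso d). Qed.
End EquivalenceProperties.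

Section RightTensor.
Variables (k : fieldType) (H : hopfAlgebra k) (A : hmodAlgebra H).
Variables (N : amodule A) (X : hmodule H).

Definition rtens_aact (a : A) (t : htens N X) : htens N X := \ten_(n, x <- t) aact a n ⊗ x.

Lemma rtens_aact_bilin : bilin rtens_aact.
Proof. by rewrite /rtens_aact; multibil. Qed.

Lemma rtens_aact_pure a n x : rtens_aact a (n ⊗ x) = aact a n ⊗ x.
Proof. by rewrite /rtens_aact ten_pure //; multibil. Qed.

Lemma rtens_aact1 t : rtens_aact (aone A) t = t.
Proof.
have bl := rtens_aact_bilin.
move: t; apply: (@tens_ext _ _ _ _ _ _ _ _ id) => //; first by multilin.
by move=> n x; rewrite rtens_aact_pure aact1.
Qed.

Lemma rtens_aactM a b t : rtens_aact (amul a b) t = rtens_aact a (rtens_aact b t).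
Proof.
have bl := rtens_aact_bilin.
move: t; apply: tens_ext; [by multilin | by multilin |] => n x.
by rewrite !rtens_aact_pure aactM.
Qed.

Lemma htens_hact_pure h (n : N) (x : X) :
  @hact k H (htens N X) h (n ⊗ x) = \ten_(h1, h2 <- cop h) hact h1 n ⊗ hact h2 x.
Proof. exact: (diag_act_pure (hact_hmodule N) (hact_hmodule X)). Qed.

Lemma rtens_hact_aact h a t : hact h (rtens_aact a t) =
  \ten_(h1, h2 <- cop h) rtens_aact (hact h1 a) (hact h2 t).
Proof.
have bl := rtens_aact_bilin.
move: t; apply: tens_ext; [by multilin | by multilin |] => n x.
rewrite rtens_aact_pure htens_hact_pure.
transitivity (\ten_(h', h3 <- cop h) \ten_(h1, h2 <- cop h')
    aact (hact h1 a) (hact h2 n) ⊗ hact h3 x).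
  by apply: eq_tev => h' h3; rewrite hact_aact (lin_tev _ _ ((tpure_bilin _ _).1 _)).
rewrite copA3r; try by move=> ? ?; multilin.
apply: eq_tev => h1 h'; rewrite htens_hact_pure (lin_tev _ _ (bl.2 _)).
by apply: eq_tev => h2 h3; rewrite rtens_aact_pure.
Qed.

Definition rtens : amodule A :=
  @AModule k H A (htens N X) rtens_aact rtens_aact_bilin rtens_aact1 rtens_aactM
    rtens_hact_aact.
End RightTensor.

(** * Morphisms into [A] seen through the functor *)

Section Representation.
Variables (k : fieldType) (H : hopfAlgebra k) (B A : hmodAlgebra H) (M : hbimodule B A).
Hypothesis eM : is_equivalence (tensor_functor M).

Local Notation "m ⊗A n" := (tpure (@ract k H B A M) (@aact k H A _) m n) (at level 40).

Definition tensor_unit (x : tens_amod M (regmod A)) : M := tev (@ract k H B A M) x.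

Lemma tensor_unit_pure m a : tensor_unit (m ⊗A a) = ract m a.
Proof.
by rewrite /tensor_unit tev_pure //; [exact: ract_bilin | move=> v r w; rewrite ractM].
Qed.

(** In [M ⊗_A A] one has [m ⊗ g(n) = m g(n) ⊗ 1], so the functor kills [g]. *)
Lemma tensor_faithful (N : amodule A) (g : N -> regmod A) : amod_morph g ->
  (forall (m : M) n, ract m (g n) = 0) -> forall n, g n = 0.
Proof.
move=> gP g0 n.
have zP : amod_morph (fun _ : N => 0 : regmod A).
  split=> [a u v|h u|a u]; first by rewrite scaler0 addr0.
    by rewrite (lin0 ((hact_bilin _).2 h)).
  by rewrite (lin0 ((aact_bilin _).2 a)).
suff: exist _ g gP = exist _ _ zP :> amod_mor N (regmod A) by move/(congr1 (fun f => sval f n)).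
apply: (equivalence_faithful eM); apply: amod_mor_eq => /=.
apply: tens_ext; [by case: (tens_fun_morph M (exist _ g gP)) |
  by case: (tens_fun_morph M (exist _ _ zP)) |] => m n'.
rewrite !tens_fun_pure /= (lin0 ((tpure_bilin _ _).2 m)).
have -> : g n' = aact (g n' : A) (aone A : regmod A) by rewrite /= amula1.
by rewrite -tpure_bal g0 (lin0 ((tpure_bilin _ _).1 _)).
Qed.

(** Followed by the map [m] to [m ⊗ 1] into [M ⊗_A A], [q] becomes a morphism between values of the
    functor, to which fullness applies. *)
Lemma tensor_full (N : amodule A) (q : tens_amod M N -> M) :
  linear q -> (forall h x, q (hact h x) = hact h (q x)) ->
  (forall b x, q (aact b x) = lact b (q x)) ->
  exists g : amod_mor N (regmod A), forall m n, ract m (sval g n) = q (m ⊗A n).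
Proof.
move=> lq hq bq.
pose p (x : tens_amod M N) : tens_amod M (regmod A) := q x ⊗A (aone A : regmod A).
have lp1 : linear (fun m : M => m ⊗A (aone A : regmod A)) by exact: (tpure_bilin _ _).1.
have pP : amod_morph p.
  split=> [|h x|b x]; first exact: lin_comp lp1 lq.
    rewrite /p hq [RHS]tens_hact_pure.
    rewrite -(counitr_lin h (f := fun g => hact g (q x) ⊗A (aone A : regmod A)));
      last by multilin.
    apply: eq_tev => h1 h2.
    by rewrite [hact h2 _]hact_aone (lin_scale ((tpure_bilin _ _).2 _)).
  by rewrite /p bq [RHS]tens_aact_pure.
have [g gE] := equivalence_full eM
  (exist _ p pP : mor (tensor_functor M N) (tensor_functor M (regmod A))).
exists g => m n; have /(congr1 (fun f => tensor_unit (sval f (m ⊗A n)))) /= := gE.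
by rewrite tens_fun_pure /p !tensor_unit_pure ract1.
Qed.

End Representation.

(** * Linear endomorphisms of [M] *)

Section Morita.
Variables (k : fieldType) (H : hopfAlgebra k) (B A : hmodAlgebra H) (M : hbimodule B A).
Hypothesis eM : is_equivalence (tensor_functor M).
Local Notation S' := (@antipodeV k H).

Local Notation "m ⊗A n" := (tpure (@ract k H B A M) (@aact k H A _) m n) (at level 40).

(** The hypotheses make [F] a morphism from [M ⊗_A (N ⊗ X)] to [M]. The factor [X], on which [A]
    does not act, is a space of parameters: [X = M] gives the pairing of a Morita context, and
    [X = H] captures endomorphisms that are not [H]-linear. *)
Lemma trilinear_representation (N : amodule A) (X : hmodule H) (F : M -> N -> X -> M) :
  (forall n x, linear (fun m => F m n x)) -> (forall m x, linear (fun n => F m n x)) ->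
  (forall m n, linear (F m n)) ->
  (forall m a n x, F (ract m a) n x = F m (aact a n) x) ->
  (forall h m n x, hact h (F m n x) = \ten_(h1, h' <- cop h) \ten_(h2, h3 <- cop h')
     F (hact h1 m) (hact h2 n) (hact h3 x)) ->
  (forall b m n x, F (lact b m) n x = lact b (F m n x)) ->
  exists g : N -> X -> A, bilin g /\ forall m n x, ract m (g n x) = F m n x.
Proof.
move=> F1 F2 F3 Fbal Fh Fb.
have bF m : bilin (F m) by split=> [x|n]; [apply: F2 | apply: F3].
pose G m (t : rtens N X) : M := \ten_(n, x <- t) F m n x.
have Gp m n x : G m (n ⊗ x) = F m n x by rewrite /G ten_pure.
have bG : bilin G.
  by split=> [t|m]; [apply: tev_param_linear => n x; apply: F1 | apply: tev_linear].
have Gbal m a t : G (ract m a) t = G m (aact a t).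
  have la : linear (aact a : rtens N X -> rtens N X) by exact: (aact_bilin _).2.
  move: t; apply: tens_ext; [exact: bG.2 | exact: lin_comp (bG.2 m) la |] => n x.
  by rewrite /= rtens_aact_pure !Gp Fbal.
pose q (y : tens_amod M (rtens N X)) : M := tev G y.
have lq : linear q by apply: tev_linear.
have qp m t : q (m ⊗A t) = G m t by rewrite /q tev_pure.
have [h y|b y|g gE] := tensor_full eM (N := rtens N X) lq.
- have lh : linear (hact h : tens_amod M (rtens N X) -> _) by exact: (hact_bilin _).2.
  have lh' : linear (hact h : M -> M) by exact: (hact_bilin _).2.
  move: y; apply: tens_ext; [exact: lin_comp lq lh | exact: lin_comp lh' lq |] => m t.
  rewrite qp [hact h _]tens_hact_pure (lin_tev _ _ lq).
  under eq_tev => h1 h2 do rewrite qp.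
  have ll : linear (fun t : rtens N X => \ten_(h1, h2 <- cop h) G (hact h1 m) (hact h2 t)).
    by multilin.
  move: t; apply: tens_ext; [exact: ll | exact: lin_comp lh' (bG.2 m) |] => n x.
  rewrite Gp Fh; apply: eq_tev => h1 h'.
  rewrite htens_hact_pure (lin_tev _ _ (bG.2 _)).
  by apply: eq_tev => h2 h3; rewrite Gp.
- have lb : linear (aact b : tens_amod M (rtens N X) -> _) by exact: (aact_bilin _).2.
  have lb' : linear (lact b : M -> M) by exact: (lact_bilin _).2.
  move: y; apply: tens_ext; [exact: lin_comp lq lb | exact: lin_comp lb' lq |] => m t.
  rewrite qp [aact b _]tens_aact_pure qp.
  have ll : linear (G (lact b m)) by exact: bG.2.
  move: t; apply: tens_ext; [exact: ll | exact: lin_comp lb' (bG.2 m) |] => n x.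
  by rewrite !Gp Fb.
exists (fun n x => sval g (n ⊗ x)); split=> [|m n x]; last by rewrite gE qp Gp.
have [lg _ _] := svalP g.
by split=> ?; apply: lin_comp lg _; multilin.
Qed.

(** The functor sends [N] to the regular module [B], up to the isomorphism [iota]; [g] represents
    the map taking [(m, n, m')] to [iota(m ⊗ n) m']. A presentation of [x0] will serve as a dual
    basis of [M] over [A]. *)
Lemma morita_context : exists (N : amodule A) (iota : tens_amod M N -> B)
    (x0 : tens_amod M N) (g : N -> M -> A),
  [/\ linear iota /\ iota x0 = aone B,
      forall b x, iota (aact b x) = amul b (iota x),
      bilin g & forall m n m', ract m (g n m') = lact (iota (m ⊗A n)) m'].
Proof.
have [N [i [j [ji ij]]]] := equivalence_onto eM (regmod B).
have [li hi bi] := svalP i.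
pose F (m : M) (n : N) (m' : M) := lact (sval i (m ⊗A n)) m'.
have li1 n : linear (fun m : M => sval i (m ⊗A n)).
  by apply: lin_comp li _; exact: (tpure_bilin _ _).1.
have li2 (m : M) : linear (fun n : N => sval i (m ⊗A n)).
  by apply: lin_comp li _; exact: (tpure_bilin _ _).2.
have l1 m' : linear (fun b : B => lact b (m' : M)) by exact: (lact_bilin _).1.
have [||||||g [bg gE]] := @trilinear_representation N M F.
- by move=> n x; apply: lin_comp (l1 x) (li1 n).
- by move=> m x; apply: lin_comp (l1 x) (li2 m).
- by move=> m n; exact: (lact_bilin _).2.
- by move=> m a n x; rewrite /F tpure_bal.
- move=> h m n x; rewrite /F hact_lact.
  transitivity (\ten_(h', h3 <- cop h) \ten_(h1, h2 <- cop h')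
      lact (sval i (hact h1 m ⊗A hact h2 n)) (hact h3 x)).
    apply: eq_tev => h' h3.
    rewrite -[hact h' _]hi [hact h' _]tens_hact_pure (lin_tev _ _ li).
    by rewrite (lin_tev _ _ (l1 _)).
  rewrite copA3r //.
  + move=> y z; apply: lin_comp (l1 _) _; apply: lin_comp (li1 _) _; exact: (hact_bilin _).1.
  + move=> y z; apply: lin_comp (l1 _) _; apply: lin_comp (li2 _) _; exact: (hact_bilin _).1.
  + by move=> y z; multilin.
- move=> b m n x; rewrite /F -lactM; congr (lact _ _).
  by have := bi b (m ⊗A n); rewrite [aact b _]tens_aact_pure.
exists N, (sval i), (sval j (aone B)), g; split=> //.
split=> //; exact: (congr1 (fun f => sval f (aone B)) ij).
Qed.

(** [b] equals [iota] of [b x0], and [b] kills the first components of [x0]. *)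
Lemma left_faithful (b : B) : (forall m : M, lact b m = 0) -> b = 0.
Proof.
move=> b0; have [N [iota [x0 [g [[liota iota1] iotaM _ _]]]]] := morita_context.
rewrite -[b]amula1 -iota1 -iotaM /= /tens_aact.
rewrite (lin_tev _ _ liota); apply: big1 => p _.
by rewrite b0 (lin0 ((tpure_bilin _ _).1 _)) (lin0 liota).
Qed.

(** By [iotaE] the components [p.1] of [x0] generate [M] over [A], with coordinates [g p.2]. So [t]
    is determined by the [t p.1], which define [b]. *)
Lemma right_linear_endo (t : M -> M) : linear t ->
  (forall m a, t (ract m a) = ract (t m) a) -> exists b : B, forall m, t m = lact b m.
Proof.
move=> lt tA; have [N [iota [x0 [g [[liota iota1] iotaM bg gE]]]]] := morita_context.
have iotaE m : m = \sum_(p <- repr x0) ract p.1 (g p.2 m).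
  rewrite -[m in LHS]lact1 -iota1 [x0 in LHS]tensE (lin_sum _ _ liota).
  rewrite (lin_sum _ _ ((lact_bilin _).1 m)); apply: eq_bigr => p _.
  by rewrite gE.
exists (\sum_(p <- repr x0) iota (t p.1 ⊗A p.2)) => m.
rewrite [m in LHS]iotaE (lin_sum _ _ lt) (lin_sum _ _ ((lact_bilin _).1 m)).
by apply: eq_bigr => p _; rewrite tA gE.
Qed.

(** Faithfulness concerns [H]-linear maps, so [a] is spread over its orbit by the map [c ⊗ h] to
    [c h(a)] on [A ⊗ H]. The functor kills this map because the annihilator of [M] is stable under
    [H]: [m h(a)] is the sum of [h2(S^-1(h1)(m) a)]. *)
Lemma right_faithful (a : A) : (forall m : M, ract m a = 0) -> a = 0.
Proof.
move=> a0.
have ha0 (m : M) h : ract m (hact h a) = 0.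
  transitivity (\ten_(h', h3 <- cop h) \ten_(h1, h2 <- cop h')
      ract (hact (h2 * S' h1) m) (hact h3 a)).
    rewrite copA3r; try by move=> ? ?; multilin.
    rewrite (contract_l (@antipodeVr _ H) _ (F := fun p q => ract (hact p m) (hact q a)));
      try by multibil.
    by rewrite hact1.
  rewrite copA3r; try by move=> ? ?; multilin.
  apply: big1 => p _.
  transitivity (hact p.2 (ract (hact (S' p.1) m) a)); last first.
    by rewrite a0 (lin0 ((hact_bilin _).2 _)).
  by rewrite hact_ract; apply: eq_tev => h2 h3; rewrite hactM.
pose g (y : rtens (regmod A) (hreg H)) : regmod A := \ten_(c, h <- y) amul c (hact h a).
have lg : linear g by rewrite /g; multilin.
have gp c h : g (c ⊗ h) = amul c (hact h a).
  by rewrite /g ten_pure //; multibil.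
have gP : amod_morph g.
  split=> // [h y|b y].
    have lh : linear (hact h : rtens (regmod A) (hreg H) -> _) by exact: (hact_bilin _).2.
    have lh' : linear (hact h : regmod A -> _) by exact: (hact_bilin _).2.
    move: y; apply: tens_ext; [exact: lin_comp lg lh | exact: lin_comp lh' lg |] => c h'.
    rewrite gp htens_hact_pure (lin_tev _ _ lg) [RHS]hact_amul.
    by apply: eq_tev => h1 h2; rewrite gp hactM.
  have lb : linear (aact b : rtens (regmod A) (hreg H) -> _) by exact: (aact_bilin _).2.
  have lb' : linear (aact b : regmod A -> _) by exact: (aact_bilin _).2.
  move: y; apply: tens_ext; [exact: lin_comp lg lb | exact: lin_comp lb' lg |] => c h.
  by rewrite gp /= rtens_aact_pure gp amulA.
rewrite -[a]amul1a -[a]hact1 -gp; apply: (tensor_faithful eM gP) => m.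
apply: tens_ext; first by apply: lin_comp lg; exact: (ract_bilin _).2.
  by move=> c u v; rewrite scaler0 addr0.
by move=> c h; rewrite gp ractM ha0.
Qed.

Lemma left_linear_endo (t : M -> M) : linear t ->
  (forall b m, t (lact b m) = lact b (t m)) -> exists a : A, forall m, t m = ract m a.
Proof.
move=> lt tB.
(* The conjugate of [t] by [h], at [m c]. With [X] the regular module the whole family is
   represented at once, and [t] is recovered at [c = 1], [h = 1]. *)
pose F (m : M) (c : regmod A) (h : hreg H) : M :=
  \ten_(h1, h2 <- cop (h : H)) hact h2 (t (hact (S' h1) (ract m c))).
have [||||||g [bg gE]] := @trilinear_representation (regmod A) (hreg H) F.
- by move=> n x; rewrite /F; multilin.
- by move=> m x; rewrite /F; multilin.
- by move=> m n; rewrite /F; multilin.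
- by move=> m a n x; rewrite /F /= ractM.
- move=> h m c x; rewrite /F (lin_tev _ _ ((hact_bilin _).2 h)).
  symmetry.
  transitivity (\ten_(x1, x2 <- cop (x : H)) \ten_(h1, k1 <- cop h) \ten_(h2, k2 <- cop k1)
     \ten_(h3, h4 <- cop k2)
    hact (h4 * x2) (t (hact (S' x1 * S' h3) (ract (hact h1 m) (hact h2 c))))).
    rewrite [RHS]tevC; apply: eq_tev => h1 k1.
    rewrite [RHS]tevC; apply: eq_tev => h2 k2.
    rewrite copM_ten; last by multibil.
    by rewrite tevC; apply: eq_tev => x1 x2; apply: eq_tev => h3 h4; rewrite antipodeVM.
  apply: eq_tev => x1 x2.
  (* The actions of [h] on [m] and on [c] recombine into one on [m c], which cancels against
     [S^-1(h3)]. *)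
  transitivity (\ten_(h', k2 <- cop h) \ten_(h3, h4 <- cop k2)
     hact (h4 * x2) (t (hact (S' x1 * (S' h3 * h')) (ract m c)))).
    rewrite copA3; try by move=> ? ?; multilin.
    apply: eq_tev => h' k2; rewrite tevC; apply: eq_tev => h3 h4.
    rewrite mulrA (hactM _ h') hact_ract.
    have ll : linear (fun y => hact (h4 * x2) (t (hact (S' x1 * S' h3) y))) by multilin.
    by rewrite (lin_tev _ _ ll).
  rewrite (copA3 (T := fun h' h3 h4 =>
      hact (h4 * x2) (t (hact (S' x1 * (S' h3 * h')) (ract m c)))));
    try by move=> ? ?; multilin.
  rewrite -[RHS](counitl_lin h (f := fun g => hact g (hact x2 (t (hact (S' x1) (ract m c))))));
    last by multilin.
  apply: eq_tev => h' h4.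
  rewrite (contract (@antipodeVl _ H) (f := fun g =>
      hact (h4 * x2) (t (hact (S' x1 * g) (ract m c)))));
    last by multilin.
  by rewrite mulr1 hactM.
- move=> b m c x; rewrite /F.
  transitivity (\ten_(x', x3 <- cop (x : H)) \ten_(x1, x2 <- cop x')
     hact x3 (lact (hact (S' x2) b) (t (hact (S' x1) (ract m c))))).
    apply: eq_tev => x' x3; rewrite lractA hact_lact cop_antipodeV_ten; last by multibil.
    have ll : linear (fun y => hact x3 (t y)) by multilin.
    by rewrite (lin_tev _ _ ll); apply: eq_tev => x1 x2; rewrite tB.
  rewrite copA3r; try by move=> ? ?; multilin.
  rewrite (lin_tev _ _ ((lact_bilin _).2 b)); apply: eq_tev => x1 x'.
  transitivity (\ten_(x2, x'' <- cop x') \ten_(x3, x4 <- cop x'')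
     lact (hact (x3 * S' x2) b) (hact x4 (t (hact (S' x1) (ract m c))))).
    apply: eq_tev => x2 x''; rewrite hact_lact.
    by apply: eq_tev => x3 x4; rewrite hactM.
  rewrite (contract_l (@antipodeVr _ H) _ (F := fun p q => lact (hact p b)
    (hact q (t (hact (S' x1) (ract m c)))))); try by multibil.
  by rewrite hact1.
exists (g (aone A) 1) => m; rewrite gE /F cop1_ten; last by multibil.
by rewrite antipodeV1 !hact1 ract1.
Qed.

End Morita.

(** * Morita invariance *)

Section MoritaInvariance.
Variables (k : fieldType) (H : hopfAlgebra k) (B A : hmodAlgebra H) (M : hbimodule B A).
Hypothesis eM : is_equivalence (tensor_functor M).
Implicit Types (m : M) (z : (H ⊗ A)%type) (w : (H ⊗ B)%type).

Lemma left_op_faithful w w' :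
  (forall m, left_op w (1 ⊗ m) = left_op w' (1 ⊗ m)) -> w = w'.
Proof.
move=> ww'; apply: slice_inj => phi lphi; apply: subr0_eq.
have sE v m : lact (slice phi v) m = slice phi (left_op v (1 ⊗ m)).
  by rewrite left_op_unit (slice_map (f := fun b => lact b m)) //; multilin.
apply: (left_faithful eM) => m.
by rewrite (linB _ _ ((lact_bilin _).1 m)) !sE ww' subrr.
Qed.

(** The difference is related to 0. In the form of [relatedP], where [H] does not act on [m] next to
    [a], each slice of it annihilates [M]. *)
Lemma right_op_faithful z z' :
  (forall x : (H ⊗ M)%type, right_op z x = right_op z' x) -> z = z'.
Proof.
move=> zz'; apply: subr0_eq.
have /relatedP z0 : related M (z - z') 0.
  move=> x; rewrite (linB _ _ ((right_op_bilin _).1 x)) zz' subrr.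
  by rewrite (lin0 ((left_op_bilin _).1 x)).
apply: slice_inj => phi lphi; rewrite (lin0 (slice_linear lphi)).
apply: (right_faithful eM) => m.
have be := @centraliser_ev_bilin _ _ _ _ M.
rewrite -(slice_map (f := fun a => ract m a)) //; last by multilin.
have lc := @centre_coact_linear k H B.
have l2 : linear (fun y : (H ⊗ (H ⊗ B))%type => \ten_(h, y <- y) h ⊗ centraliser_ev y m).
  by multilin.
by rewrite z0 (lin0 lc) (lin0 l2) (lin0 (slice_linear lphi)).
Qed.

Lemma related_left_unique z w w' : related M z w -> related M z w' -> w = w'.
Proof. by move=> zw zw'; apply: left_op_faithful => m; rewrite zw zw'. Qed.

Lemma related_right_unique z z' w : related M z w -> related M z' w -> z = z'.
Proof. by move=> zw zw'; apply: right_op_faithful => x; rewrite -zw -zw'. Qed.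

(** [right_op z] coincides with [left_op w], which commutes with the right action of [A];
    faithfulness turns this into the centre condition at [1 ⊗ c]. *)
Lemma related_in_centre_right z w : related M z w -> in_centre z.
Proof.
move=> zw; apply: (@related_unit _ _ _ _ (regbimod A)) => c.
apply: right_op_faithful => x; rewrite -[RHS]right_op_ract -zw left_op_ract zw.
by rewrite leg_ract_right_op.
Qed.

Lemma related_in_centre_left z w : related M z w -> in_centre w.
Proof.
move=> zw; apply: (@related_unit _ _ _ _ (regbimod B)) => c.
apply: left_op_faithful => m.
rewrite -tensor_mulE left_op_mul left_op_pure mulr1 zw.
(* [N] is what the left action of [c] on [M] becomes on passing through [right_op z]; applied after
   [left_op w] at [1 ⊗ m] it yields the operator of [twist_mul w (1 ⊗ c)]. *)
pose N (x : (H ⊗ M)%type) := \ten_(g, m <- x) \ten_(g1, g2 <- cop g) g1 ⊗ lact (hact g2 c) m.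
have lN : linear N by rewrite /N; multilin.
transitivity (N (left_op w (1 ⊗ m))).
  rewrite zw; move: z {zw}; apply: tens_ext; [by multilin | by multilin |] => u a.
  rewrite !right_op_unit_pure /N ten_map; last by multibil.
  rewrite copA3r; try by move=> ? ?; multilin.
  apply: eq_tev => u1 u'; rewrite hact_lact.
  rewrite (lin_tev _ _ ((ract_bilin _).1 a)) (lin_tev _ _ ((tpure_bilin _ _).2 _)).
  by apply: eq_tev => u2 u3; rewrite lractA.
move: w {zw}; apply: tens_ext; [by multilin | |] => [|v b].
  by apply: lin_comp (fun w => left_op w (1 ⊗ m)) _ _ _; multilin.
rewrite left_op_pure mulr1 /N ten_pure; last by multibil.
rewrite [right_op _ _]twist_mul_pure (lin_tev _ _ ((left_op_bilin _).1 _)).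
by apply: eq_tev => v1 v2; rewrite left_op_pure !mulr1 lactM.
Qed.

(** [centre_ev] is [right_op] at [1 ⊗ m] followed by the counit, and for central [z] this operator
    commutes with the right action of [A]. *)
Lemma centre_ev_ract z m c : in_centre z -> centre_ev z (ract m c) = ract (centre_ev z m) c.
Proof.
move=> cz.
have lc := @counit_linear _ H.
have be := @centre_ev_bilin _ _ _ _ M.
have ls := slice_linear (W := M) lc.
have evE y m' : centre_ev y m' = slice (@counit k H) (right_op y (1 ⊗ m')).
  move: y; apply: tens_ext; [by multilin | by multilin |] => u a.
  rewrite centre_ev_pure right_op_unit_pure (lin_tev _ _ ls).
  rewrite -[LHS](counitl_lin u (f := fun u => ract (hact u m') a)); last by multilin.
  by apply: eq_tev => u1 u2; rewrite slice_pure.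
rewrite !evE -leg_ract_pure right_op_ract -cz -leg_ract_right_op.
by rewrite -(slice_map (f := fun m => ract m c)) //; multilin.
Qed.

(** Both sides evaluate on [m] the equation [x (b # 1) = (b # 1) x] in [B # H], taken in the form of
    [relatedP]. *)
Lemma centraliser_ev_lact w b m :
  in_centre w -> centraliser_ev w (lact b m) = lact b (centraliser_ev w m).
Proof.
move=> cw; have be := @centraliser_ev_bilin _ _ _ _ M.
have be' := @centraliser_ev_bilin _ _ _ _ (regbimod B).
have := (@relatedP _ _ _ _ (regbimod B) w w).1 cw b.
move/(congr1 (fun y => centraliser_ev (M := M) y m)).
rewrite !(lin_tev _ _ (be.1 m)) => E.
transitivity (\ten_(v, c <- w) centraliser_ev (v ⊗ (amul b c : B)) m); last first.
  rewrite (lin_tev _ _ ((lact_bilin _).2 b)); apply: eq_tev => v c.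
  by rewrite centraliser_ev_pure lactM.
apply: etrans (esym E); move: {cw E} w.
apply: tens_ext; [by multilin | by multilin |] => v c.
rewrite centraliser_ev_pure centre_coact_pure ten_map; last by multibil.
rewrite hact_lact cop_antipodeV_ten; last by multibil.
rewrite (lin_tev _ _ ((lact_bilin _).2 c)); apply: eq_tev => v1 v2.
by rewrite (centraliser_ev_pure (M := regbimod B)) centraliser_ev_pure lactM.
Qed.

(** The slices of the coaction of [z] are central, so each evaluates to a right [A]-linear map, that
    is, to left multiplication by some [b]. The first legs reassemble these into [w]. *)
Lemma related_left_exists z : in_centre z -> exists w, related M z w.
Proof.
move=> cz; have be := @centre_ev_bilin _ _ _ _ M.
have [l lE] := slice_basis (centre_coact z).
have bP (p : H * {phi : H -> k | scalar phi}) : exists b : B,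
    forall m, centre_ev (slice (sval p.2) (centre_coact z)) m = lact b m.
  apply: (right_linear_endo eM) => [|m c]; first by multilin.
  by apply/centre_ev_ract/in_centre_coslice => //; exact: (svalP p.2).
have [b bE] := choice bP.
exists (\sum_(p <- l) p.1 ⊗ b p); apply: related_unit => m.
have ll : linear (fun y : (H ⊗ (H ⊗ A))%type => \ten_(h, y <- y) h ⊗ centre_ev (M := M) y m).
  by multilin.
rewrite right_op_unit lE (lin_sum _ _ ll) (lin_sum _ _ ((left_op_bilin _).1 _)).
apply: eq_bigr => p _; rewrite left_op_pure mulr1 ten_pure ?bE //.
by multibil.
Qed.

(** The mirror argument, on the slices of the coaction of [w] and with the form of the relation in
    [relatedP]. *)
Lemma related_right_exists w : in_centre w -> exists z, related M z w.
Proof.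
move=> cw; have be := @centraliser_ev_bilin _ _ _ _ M.
have [l lE] := slice_basis (centre_coact w).
have aP (p : H * {phi : H -> k | scalar phi}) : exists a : A,
    forall m, centraliser_ev (slice (sval p.2) (centre_coact w)) m = ract m a.
  apply: (left_linear_endo eM) => [|b m]; first by multilin.
  by apply/centraliser_ev_lact/in_centre_coslice => //; exact: (svalP p.2).
have [a aE] := choice aP.
exists (\sum_(p <- l) p.1 ⊗ a p); apply/relatedP => m.
have ll : linear (fun y : (H ⊗ (H ⊗ B))%type =>
    \ten_(h, y <- y) h ⊗ centraliser_ev (M := M) y m) by multilin.
have ll' : linear (fun z => \ten_(u, a <- z) u ⊗ ract m a) by multilin.
rewrite lE (lin_sum _ _ ll) (lin_sum _ _ ll').
by apply: eq_bigr => p _; rewrite !ten_pure ?aE //; multibil.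
Qed.

(** [f] has the relation as its graph. Uniqueness of related elements ([fU]) converts each
    compatibility of the relation into one of [f]. *)
Lemma centralisers_isomorphic (s : ydData H (centraliser A)) (t : ydData H (centraliser B)) :
  yd_morphism s (centre_data A) (@centre_of k H A) ->
  yd_morphism t (centre_data B) (@centre_of k H B) -> yd_isomorphic s t.
Proof.
move=> [ls sact scoact smul sone] [lt tact tcoact tmul tone].
have fP (x : centraliser A) : exists y : centraliser B, related M (centre_of x) (centre_of y).
  have [w zw] := related_left_exists (centre_of_in x).
  by have [y yw] := centre_of_onto (related_in_centre_left zw); exists y; rewrite yw.
have gP (y : centraliser B) : exists x : centraliser A, related M (centre_of x) (centre_of y).
  have [z zw] := related_right_exists (centre_of_in y).
  by have [x xz] := centre_of_onto (related_in_centre_right zw); exists x; rewrite xz.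
have [[f fE] [g gE]] := (choice fP, choice gP).
have fU x y : related M (centre_of x) (centre_of y) -> f x = y.
  by move=> xy; apply: centre_of_inj; apply: related_left_unique (fE x) xy.
have lf : linear f.
  by move=> a x y; apply: fU; rewrite ls lt; apply: related_linear; apply: fE.
have lcf : linear (fun x => centre_of (f x)) by exact: lin_comp lt lf.
exists f; split.
- split=> //; exists g => [x|y]; last exact/fU/gE.
  by apply: centre_of_inj; apply: related_right_unique (gE _) (fE _).
- by move=> h x; apply: fU; rewrite sact tact; apply: related_act; apply: fE.
- move=> x; apply: (map_tens_inj lt (@centre_of_inj k H B)) => /=.
  rewrite -tcoact ten_map; last by multibil.
  (* Colinearity is tested on slices: these are coslices of related elements, hence related. *)
  apply: slice_inj => phi lphi; rewrite slice_map //.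
  apply: related_left_unique (related_coslice lphi (fE x)) _.
  by rewrite /coslice [centre_coact _]scoact slice_map.
- move=> x y; apply: fU; rewrite smul tmul.
  by apply: related_mul; [exact: centre_of_in | exact: fE | exact: fE].
- by apply: fU; rewrite sone tone; apply: related1.
Qed.

End MoritaInvariance.

Theorem corollary5p4 (k : fieldType) (H : hopfAlgebra k) :
  (forall A : hmodAlgebra H, exists s : ydData H (centraliser A),
     [/\ is_centraliser_yd s, is_yd_algebra s & yd_commutative s]) /\
  (forall (A B : hmodAlgebra H) (M : hbimodule B A),
     is_equivalence (tensor_functor M) ->
     forall (s : ydData H (centraliser A)) (t : ydData H (centraliser B)),
       is_centraliser_yd s -> is_centraliser_yd t -> yd_isomorphic s t).
Proof.
split=> [A | A B M eM s t /is_centraliser_ydP sP /is_centraliser_ydP tP].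
  have [s sP] := centraliser_yd_exists A; have [? ?] := centraliser_yd_algebra sP.
  by exists s; split=> //; apply/is_centraliser_ydP.
exact: (centralisers_isomorphic eM sP tP).
Qed.
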